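(* Let $a=(a_1,a_2,\dots)\in X$. The equation $$\frac{dv}{dx}=\sum_{i=1}^{\infty}a_i(x)v^{i+1}$$ determines a center if and only if the monodromy $\rho$ of the linear equation $$\frac{dF}{dx}=\Big(\sum_{i=1}^{\infty}a_i(x)\,t^i S_1S_2^{i-1}\Big)F$$ on $S^1$ is trivial.
   Context: Functions on the circle $S^1$ are identified with $2\pi$-periodic functions on $\mathbb{R}$. $X$ is the complex vector space of sequences $a=(a_1,a_2,\dots)$ with $a_i\in L^\infty(S^1)$ (complex-valued) for which there is $l>0$ (depending on $a$) with $\sup_{x\in S^1}|a_i(x)|\le l^i$ for all $i\ge1$ (sup understood as the $L^\infty$-norm). Solutions of $v'=\sum a_i(x)v^{i+1}$ are Lipschitz functions on $[0,2\pi]$ satisfying the equation almost everywhere; for every sufficiently small initial value there is a unique such solution. The equation determines a center if for all sufficiently small initial values $v(0)$ the solution satisfies $v(2\pi)=v(0)$. $\mathcal{A}(S_1,S_2)$ is the associative unital complex algebra (unit $I$) of non-commutative polynomials in $S_1,S_2$ subject to the relation $S_1S_2-S_2S_1=-S_2^2$, and $\mathcal{A}(S_1,S_2)[[t]]$ is the algebra of formal power series in $t$ with coefficients in $\mathcal{A}(S_1,S_2)$; $G(S_1,S_2)[[t]]$ is its group of invertible elements. The linear equation has a fundamental solution $F:\mathbb{R}\to G(S_1,S_2)[[t]]$, $F(0)=I$, obtained by Picard iteration: $F(x)=I+\sum_{k\ge1}\int_{0\le s_1\le\cdots\le s_k\le x}\omega(s_k)\cdots\omega(s_1)\,ds_k\cdots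 ds_1$, where $\omega(x)=\sum_i a_i(x)t^iS_1S_2^{i-1}$; its coefficients are locally Lipschitz in $x$. The monodromy is the homomorphism $\rho:\mathbb{Z}\to G(S_1,S_2)[[t]]$, $\rho(n)=F(2\pi n)=F(2\pi)^n$; it is trivial iff $F(2\pi)=I$. *)

(* Defs.v *)
From HB Require Import structures.
From mathcomp Require Import all_boot all_order all_algebra.
From mathcomp Require Import generic_quotient ring_quotient.
(* The notations of [monalg] clash with those of MathComp-Analysis. *)
From mathcomp Require Import -(notations) monalg.
From mathcomp Require Import complex.
From mathcomp Require Import all_classical all_reals all_analysis ess_sup_inf.

Set Implicit Arguments.
Unset Strict Implicit.
Unset Printing Implicit Defensive.

Import Order.TTheory GRing.Theory Num.Theory.
Import numFieldNormedType.Exports.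

Local Open Scope classical_set_scope.
Local Open Scope ring_scope.
Local Open Scope complex_scope.

(* MathComp only provides ring quotients of commutative rings; this is the
   quotient of an associative algebra by the two-sided ideal generated by r. *)

Section PrincipalQuotient.
Variables (K : comNzRingType) (F : algType K) (r : F).

Definition ideal2 : pred F := fun x =>
  `[< exists s : seq (F * F), x = \sum_(p <- s) p.1 * r * p.2 >].

Lemma ideal2_closed : zmod_closed ideal2.
Proof.
split; first by apply/asboolP; exists [::]; rewrite big_nil.
move=> x y /asboolP[s ->] /asboolP[t ->]; apply/asboolP.
exists (s ++ [seq (- p.1, p.2) | p <- t]).
rewrite big_cat big_map/= -sumrN; congr (_ + _).
by apply: eq_bigr => p _; rewrite !mulNr.
Qed.

HB.instance Definition _ := GRing.isZmodClosed.Build F ideal2 ideal2_closed.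

Lemma ideal2Ml a x : x \in ideal2 -> a * x \in ideal2.
Proof.
move=> /asboolP[s ->]; apply/asboolP; exists [seq (a * p.1, p.2) | p <- s].
by rewrite big_map mulr_sumr; apply: eq_bigr => p _ /=; rewrite !mulrA.
Qed.

Lemma ideal2Mr a x : x \in ideal2 -> x * a \in ideal2.
Proof.
move=> /asboolP[s ->]; apply/asboolP; exists [seq (p.1, p.2 * a) | p <- s].
by rewrite big_map mulr_suml; apply: eq_bigr => p _ /=; rewrite !mulrA.
Qed.

Lemma ideal2Z c x : x \in ideal2 -> c *: x \in ideal2.
Proof. by rewrite -[x in c *: x]mul1r scalerAl; exact: ideal2Ml. Qed.

Definition quot2 := Quotient.quot (GRing.ZmodClosed.clone F ideal2 _).
HB.instance Definition _ := GRing.Zmodule.on quot2.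
HB.instance Definition _ := EqQuotient.on quot2.

Definition proj2 : F -> quot2 := \pi_quot2%qT.

Lemma proj2_eq x y : (proj2 x == proj2 y) = (x - y \in ideal2).
Proof. by rewrite Quotient.idealrBE. Qed.

Lemma proj2_repr x : proj2 (repr x) = x. Proof. exact: reprK. Qed.

Lemma repr_proj2 x : repr (proj2 x) - x \in ideal2.
Proof. by rewrite -proj2_eq proj2_repr. Qed.

Definition mulq (x y : quot2) : quot2 := proj2 (repr x * repr y).
Definition scaleq (c : K) (x : quot2) : quot2 := proj2 (c *: repr x).

Lemma proj2D x y : proj2 (x + y) = proj2 x + proj2 y.
Proof. by rewrite /proj2 !piE. Qed.

Lemma proj2N x : proj2 (- x) = - proj2 x.
Proof. by rewrite /proj2 !piE. Qed.

Lemma proj2_0 : proj2 0 = 0.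
Proof. by rewrite /proj2 !piE. Qed.

Lemma mulqE x y : mulq (proj2 x) (proj2 y) = proj2 (x * y).
Proof.
apply/eqP; rewrite proj2_eq -(subrKA (x * repr (proj2 y))).
rewrite -mulrBl -mulrBr rpredD//.
  by rewrite ideal2Mr// repr_proj2.
by rewrite ideal2Ml// repr_proj2.
Qed.

Lemma scaleqE c x : scaleq c (proj2 x) = proj2 (c *: x).
Proof. by apply/eqP; rewrite proj2_eq -scalerBr ideal2Z// repr_proj2. Qed.

Lemma mulqA : associative mulq.
Proof.
move=> x y z; rewrite -[x]proj2_repr -[y]proj2_repr -[z]proj2_repr.
by rewrite !mulqE mulrA.
Qed.

Lemma mul1q : left_id (proj2 1) mulq.
Proof. by move=> x; rewrite -[x]proj2_repr mulqE mul1r. Qed.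

Lemma mulq1 : right_id (proj2 1) mulq.
Proof. by move=> x; rewrite -[x]proj2_repr mulqE mulr1. Qed.

Lemma mulqDl : left_distributive mulq +%R.
Proof.
move=> x y z; rewrite -[x]proj2_repr -[y]proj2_repr -[z]proj2_repr.
by rewrite -proj2D !mulqE -proj2D mulrDl.
Qed.

Lemma mulqDr : right_distributive mulq +%R.
Proof.
move=> x y z; rewrite -[x]proj2_repr -[y]proj2_repr -[z]proj2_repr.
by rewrite -proj2D !mulqE -proj2D mulrDr.
Qed.

HB.instance Definition _ := GRing.Zmodule_isPzRing.Build quot2
  mulqA mul1q mulq1 mulqDl mulqDr.

Lemma proj2_1 : proj2 1 = 1. Proof. by []. Qed.

Lemma proj2M x y : proj2 (x * y) = proj2 x * proj2 y.
Proof. exact/esym/mulqE. Qed.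

Lemma scaleqA a b x : scaleq a (scaleq b x) = scaleq (a * b) x.
Proof. by rewrite -[x]proj2_repr !scaleqE scalerA. Qed.

Lemma scale1q : left_id 1 scaleq.
Proof. by move=> x; rewrite -[x]proj2_repr scaleqE scale1r. Qed.

Lemma scaleqDr : right_distributive scaleq +%R.
Proof.
move=> c x y; rewrite -[x]proj2_repr -[y]proj2_repr.
by rewrite -proj2D !scaleqE -proj2D scalerDr.
Qed.

Lemma scaleqDl x : {morph scaleq^~ x : a b / a + b}.
Proof. by move=> a b; rewrite -[x]proj2_repr !scaleqE -proj2D scalerDl. Qed.

HB.instance Definition _ := GRing.Zmodule_isLmodule.Build K quot2
  scaleqA scale1q scaleqDr scaleqDl.

Lemma proj2Z c x : proj2 (c *: x) = c *: proj2 x.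
Proof. exact/esym/scaleqE. Qed.

Lemma scaleqAl c (x y : quot2) : c *: (x * y) = (c *: x) * y.
Proof.
rewrite -[x]proj2_repr -[y]proj2_repr.
by rewrite -proj2M -!proj2Z -proj2M scalerAl.
Qed.

Lemma scaleqAr c (x y : quot2) : c *: (x * y) = x * (c *: y).
Proof.
rewrite -[x]proj2_repr -[y]proj2_repr.
by rewrite -proj2M -!proj2Z -proj2M scalerAr.
Qed.

End PrincipalQuotient.

(* The algebra A(S_1, S_2) over K: the quotient of the free associative algebra
   on two letters ([fmonom 'I_2] is the free monoid of words) by the two-sided
   ideal generated by S_1 S_2 - S_2 S_1 + S_2^2. *)

Section RiccatiAlgebra.
Variable K : comNzRingType.

(* An alias: on [malg] itself MathComp infers algebra structures for
   commutative monomials only. *)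
Definition free2 := malg (fmonom 'I_2) K.
HB.instance Definition _ := GRing.Lalgebra.on free2.

Lemma free2_scalerAr (c : K) (x y : free2) : c *: (x * y) = x * (c *: y).
Proof.
have central z : c *: z = z * malgC c.
  rewrite -mul_malgC !malgM_def fgmulUg fgmulgU; apply: eq_bigr => k _.
  by rewrite mul1m mulm1 mulrC.
by rewrite !central mulrA.
Qed.

HB.instance Definition _ :=
  GRing.Lalgebra_isAlgebra.Build K free2 free2_scalerAr.

Definition freeS1 : free2 := mkmalgU (fmu (ord0 : 'I_2)) 1.
Definition freeS2 : free2 := mkmalgU (fmu (ord_max : 'I_2)) 1.
Definition relator : free2 := freeS1 * freeS2 - freeS2 * freeS1 + freeS2 ^+ 2.

Lemma ideal2_rmorph0 (F : algType K) (f : {rmorphism F -> K}) (x y z : F) :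
  f x = 0 -> f y = 0 -> z \in ideal2 (x * y - y * x + y ^+ 2) -> f z = 0.
Proof.
move=> x0 y0 /asboolP[s ->]; rewrite rmorph_sum big1// => p _.
rewrite !rmorphM rmorphD rmorphB rmorphXn !rmorphM x0 y0.
by rewrite mulr0 expr0n subr0 addr0 mulr0 mul0r.
Qed.

Definition algA := quot2 relator.
HB.instance Definition _ := GRing.PzRing.on algA.
HB.instance Definition _ := GRing.Lmodule.on algA.

Lemma oneA_neq0 : (1 : algA) != 0.
Proof.
have fmu1 (i : 'I_2) : (fmu i == mone) = false.
  by apply/eqP => /(congr1 (@fmonom_val _)); rewrite fm1 /fmu fmE.
have S10 : mcoeff mone freeS1 = 0 by rewrite mcoeffU fmu1.
have S20 : mcoeff mone freeS2 = 0 by rewrite mcoeffU fmu1.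
pose f : {rmorphism free2 -> K} :=
  GRing.RMorphism.clone (malg (fmonom 'I_2) K) K (mcoeff mone) _.
rewrite -proj2_1 -proj2_0 proj2_eq subr0; apply/negP.
move=> /(@ideal2_rmorph0 _ f _ _ _ S10 S20)/eqP; rewrite /f /=.
by rewrite mcoeff1 eqxx oner_eq0.
Qed.

HB.instance Definition _ := GRing.PzSemiRing_isNonZero.Build algA oneA_neq0.
HB.instance Definition _ :=
  GRing.Lmodule_isLalgebra.Build K algA (@scaleqAl _ _ relator).
HB.instance Definition _ :=
  GRing.Lalgebra_isAlgebra.Build K algA (@scaleqAr _ _ relator).

Definition S1 : algA := proj2 relator freeS1.
Definition S2 : algA := proj2 relator freeS2.

Lemma S1S2_rel : S1 * S2 - S2 * S1 = - S2 ^+ 2.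
Proof.
apply/eqP; rewrite -subr_eq0 opprK expr2 -!proj2M -proj2N -!proj2D.
rewrite -proj2_0 proj2_eq subr0 -expr2; apply/asboolP; exists [:: (1, 1)].
by rewrite big_seq1 mul1r mulr1.
Qed.

End RiccatiAlgebra.

Arguments S1 {K}.
Arguments S2 {K}.

(* A[[t]], where t commutes with the coefficients. *)

Section PowerSeries.
Variable A : nzRingType.

Record fps := Fps { fpscoef : nat -> A }.

Lemma fpsP (f g : fps) : fpscoef f =1 fpscoef g -> f = g.
Proof. by case: f g => [f] [g] /= /funext ->. Qed.

HB.instance Definition _ := gen_eqMixin fps.
HB.instance Definition _ := gen_choiceMixin fps.

Definition fps0 := Fps (fun=> 0).
Definition fps1 := Fps (fun n => (n == 0)%:R).
Definition fpsN f := Fps (fun n => - fpscoef f n).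
Definition fpsD f g := Fps (fun n => fpscoef f n + fpscoef g n).
Definition fpsM f g :=
  Fps (fun n => \sum_(i < n.+1) fpscoef f i * fpscoef g (n - i)%N).

Lemma fpsDA : associative fpsD.
Proof. by move=> f g h; apply: fpsP => n /=; rewrite addrA. Qed.

Lemma fpsDC : commutative fpsD.
Proof. by move=> f g; apply: fpsP => n /=; rewrite addrC. Qed.

Lemma fps0D : left_id fps0 fpsD.
Proof. by move=> f; apply: fpsP => n /=; rewrite add0r. Qed.

Lemma fpsND : left_inverse fps0 fpsN fpsD.
Proof. by move=> f; apply: fpsP => n /=; rewrite addNr. Qed.

HB.instance Definition _ := GRing.isZmodule.Build fps fpsDA fpsDC fps0D fpsND.

Let trunc N (f : fps) : {poly A} := \poly_(i < N) fpscoef f i.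

Let fpsM_trunc N f g n : (n < N)%N ->
  fpscoef (fpsM f g) n = (trunc N f * trunc N g)`_n.
Proof.
move=> nN; rewrite coefM; apply: eq_bigr => i _.
rewrite !coef_poly (leq_ltn_trans (leq_subr _ _) nN).
by rewrite (leq_ltn_trans _ nN)// -ltnS.
Qed.

Lemma fpsMA : associative fpsM.
Proof.
move=> f g h; apply: fpsP => n; have nN := ltnSn n.
rewrite !(fpsM_trunc _ _ nN).
transitivity ((trunc n.+1 f * (trunc n.+1 g * trunc n.+1 h))`_n).
  rewrite !coefM; apply: eq_bigr => i _; congr (_ * _).
  have iN : (n - i < n.+1)%N by rewrite ltnS leq_subr.
  by rewrite coef_poly iN (fpsM_trunc _ _ iN).
rewrite mulrA !coefM; apply: eq_bigr => i _; congr (_ * _).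
by rewrite [in RHS]coef_poly ltn_ord (fpsM_trunc _ _ (ltn_ord i)).
Qed.

Lemma fps1M : left_id fps1 fpsM.
Proof.
move=> f; apply: fpsP => n /=; rewrite big_ord_recl/= mul1r subn0.
by rewrite big1 ?addr0// => i _; rewrite mul0r.
Qed.

Lemma fpsM1 : right_id fps1 fpsM.
Proof.
move=> f; apply: fpsP => n /=; rewrite big_ord_recr/= subnn mulr1.
rewrite big1 ?add0r// => i _.
by rewrite subn_eq0 leqNgt ltn_ord mulr0.
Qed.

Lemma fpsMDl : left_distributive fpsM +%R.
Proof.
move=> f g h; apply: fpsP => n /=; rewrite -big_split.
by apply: eq_bigr => i _; rewrite mulrDl.
Qed.

Lemma fpsMDr : right_distributive fpsM +%R.
Proof.
move=> f g h; apply: fpsP => n /=; rewrite -big_split.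
by apply: eq_bigr => i _; rewrite mulrDr.
Qed.

Lemma fps1_neq0 : fps1 != 0.
Proof.
by apply/eqP => /(congr1 (fpscoef^~ 0%N)) /eqP; rewrite /= oner_eq0.
Qed.

HB.instance Definition _ := GRing.Zmodule_isNzRing.Build fps
  fpsMA fps1M fpsM1 fpsMDl fpsMDr fps1_neq0.

Definition fps_unit : {pred fps} :=
  fun f => `[< exists g, g * f = 1 /\ f * g = 1 >].

Definition fps_inv (f : fps) : fps :=
  if pselect (exists g, g * f = 1 /\ f * g = 1) is left h
  then projT1 (cid h) else f.

Lemma fpsVM : {in fps_unit, left_inverse 1 fps_inv *%R}.
Proof.
move=> f /asboolP uf; rewrite /fps_inv; case: pselect => // h.
by case: cid => g /= [].
Qed.

Lemma fpsMV : {in fps_unit, right_inverse 1 fps_inv *%R}.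
Proof.
move=> f /asboolP uf; rewrite /fps_inv; case: pselect => // h.
by case: cid => g /= [].
Qed.

Lemma fps_unitP f g : g * f = 1 /\ f * g = 1 -> f \in fps_unit.
Proof. by move=> ?; apply/asboolP; exists g. Qed.

Lemma fps_inv_out : {in [predC fps_unit], fps_inv =1 id}.
Proof.
move=> f /asboolPn nf; rewrite /fps_inv.
by case: pselect.
Qed.

HB.instance Definition _ := GRing.NzRing_hasMulInverse.Build fps
  fpsVM fpsMV fps_unitP fps_inv_out.

Lemma fps_coefXn0 (f : fps) n m :
  fpscoef f 0 = 0 -> (n < m)%N -> fpscoef (f ^+ m) n = 0.
Proof.
move=> f0; elim: m n => // m IHm n; rewrite ltnS => nm.
rewrite exprS; apply: big1 => -[[|i] iN] _ /=; first by rewrite f0 mul0r.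
rewrite IHm ?mulr0//; rewrite ltnS in iN.
by rewrite ltn_subLR// (leq_ltn_trans nm) // addSn ltnS leq_addl.
Qed.

Lemma fps_unit_coef0 (f : fps) : fpscoef f 0 = 1 -> f \is a GRing.unit.
Proof.
move=> f0; set y := 1 - f.
have y0 : fpscoef y 0 = 0 by rewrite /y /= f0 subrr.
pose g := Fps (fun n => fpscoef (\sum_(k < n.+1) y ^+ k) n).
have gE N n : (n < N)%N -> fpscoef g n = fpscoef (\sum_(k < N) y ^+ k) n.
  elim: N => // N IHN; rewrite ltnS leq_eqVlt => /predU1P[->//|nN].
  rewrite (IHN nN) big_ord_recr/=.
  by rewrite -[RHS]/(_ + _) (fps_coefXn0 y0 nN) addr0.
have fE : f = 1 - y by rewrite /y opprB addrC subrK.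
have coefM_le (u v u' v' : fps) n :
    (forall i, (i <= n)%N -> fpscoef u i = fpscoef u' i) ->
    (forall i, (i <= n)%N -> fpscoef v i = fpscoef v' i) ->
    fpscoef (u * v) n = fpscoef (u' * v') n.
  move=> uu' vv'; apply: eq_bigr => i _.
  by rewrite uu' ?vv' ?leq_subr// -ltnS.
have yX n : fpscoef (1 - y ^+ n.+1) n = fpscoef (1 : fps) n.
  by rewrite -[LHS]/(_ - fpscoef (y ^+ n.+1) n) (fps_coefXn0 y0 (ltnSn n)) subr0.
have fS n : f * (\sum_(k < n) y ^+ k) = 1 - y ^+ n.
  by rewrite -[RHS]opprB subrX1 -mulNr opprB fE.
have Sf n : (\sum_(k < n) y ^+ k) * f = 1 - y ^+ n.
  rewrite -fS; apply/commr_sym/commr_sum => k _; rewrite fE.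
  by apply/commr_sym/commrB; [exact: commr1|exact/commr_sym/commrX].
apply: (@fps_unitP f g); split; apply: fpsP => n; rewrite -yX.
  by rewrite -Sf; apply: coefM_le => // i ilen; rewrite (gE n.+1).
by rewrite -fS; apply: coefM_le => // i ilen; rewrite (gE n.+1).
Qed.

Definition fps_group := {f : fps | f \is a GRing.unit}.

Definition fps_group1 : fps_group := exist _ 1 (unitr1 _).
Definition fps_groupV (x : fps_group) : fps_group :=
  exist _ (val x)^-1 (etrans (unitrV _) (valP x)).
Definition fps_groupM (x y : fps_group) : fps_group :=
  exist _ (val x * val y) (etrans (unitrMl _ (valP y)) (valP x)).

Lemma fps_groupMA : associative fps_groupM.
Proof. by move=> x y z; apply: val_inj => /=; rewrite mulrA. Qed.

Lemma fps_group1M : left_id fps_group1 fps_groupM.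
Proof. by move=> x; apply: val_inj => /=; rewrite mul1r. Qed.

Lemma fps_groupM1 : right_id fps_group1 fps_groupM.
Proof. by move=> x; apply: val_inj => /=; rewrite mulr1. Qed.

Lemma fps_groupVM : left_inverse fps_group1 fps_groupV fps_groupM.
Proof. by move=> x; apply: val_inj => /=; rewrite mulVr ?(valP x). Qed.

Lemma fps_groupMV : right_inverse fps_group1 fps_groupV fps_groupM.
Proof. by move=> x; apply: val_inj => /=; rewrite divrr ?(valP x). Qed.

HB.instance Definition _ := Choice.on fps_group.
HB.instance Definition _ := isGroup.Build fps_group
  fps_groupMA fps_group1M fps_groupM1 fps_groupVM fps_groupMV.

End PowerSeries.

Section CenterProblem.
Variable R : realType.
Notation C := R[i].
Notation mu := (@lebesgue_measure R).
Implicit Types (a : nat -> R -> C) (v : R -> C).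

(* The sequences a = (a_1, a_2, ...) of the space X, given by 2 pi-periodic
   representatives of the classes a_i in L^oo(S^1); the value a 0 is never
   used.  By periodicity the essential supremum over the line is the one over
   the circle. *)
Definition in_X a : Prop :=
  (forall i, (0 < i)%N ->
     [/\ measurable_fun [set: R] (fun x => complex.Re (a i x)),
         measurable_fun [set: R] (fun x => complex.Im (a i x))
       & periodic (a i) (pi *+ 2)]) /\
  exists2 l : R, 0 < l &
    forall i, (0 < i)%N ->
      (ess_sup mu (fun x => (Normc.normc (a i x))%:E) <= (l ^+ i)%:E)%E.

(* Convergence, derivative and integral are spelled out for values in C because
   R[i] carries no structure of normed space over R in the library. *)
Definition cseries_from1 (u : nat -> C) (z : C) : Prop :=
  (fun n => Normc.normc (\sum_(1 <= i < n.+1) u i - z)) @ \oo --> (0 : R).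

Definition cis_derive v (x : R) (z : C) : Prop :=
  is_derive x (1 : R) (fun y => complex.Re (v y)) (complex.Re z) /\
  is_derive x (1 : R) (fun y => complex.Im (v y)) (complex.Im z).

Definition clipschitz (D : set R) v : Prop :=
  exists L : R, forall x y, D x -> D y -> Normc.normc (v x - v y) <= L * `|x - y|.

Definition is_solution a v : Prop :=
  clipschitz `[0, pi *+ 2] v /\
  {ae mu, forall x, x \in `[0, pi *+ 2] ->
    exists2 z : C, cseries_from1 (fun i => a i x * v x ^+ i.+1) z
                 & cis_derive v x z}.

(* As the a_i are complex-valued, initial values range over a disc in C; the
   solution with a given small initial value exists and is unique. *)
Definition determines_center a : Prop :=
  exists2 r : R, 0 < r &
    forall v, is_solution a v -> Normc.normc (v 0) < r -> v (pi *+ 2) = v 0.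

Definition cintegral (D : set R) (f : R -> C) : C :=
  (\int[mu]_(x in D) complex.Re (f x)) +i* (\int[mu]_(x in D) complex.Im (f x)).

Definition cintegral0 (f : R -> C) (x : R) : C :=
  if 0 <= x then cintegral `[0, x] f else - cintegral `[x, 0] f.

(* For w = [:: i_k; ...; i_1], the integral of a_{i_k}(s_k) ... a_{i_1}(s_1)
   over 0 <= s_1 <= ... <= s_k <= x, with the usual orientation if x < 0. *)
Fixpoint iter_integral a (w : seq nat) : R -> C :=
  if w is i :: w' then cintegral0 (fun s => a i s * iter_integral a w' s)
  else fun=> 1.

(* For w = [:: i_k; ...; i_1], the product
   (S_1 S_2^{i_k - 1}) ... (S_1 S_2^{i_1 - 1}). *)
Definition word_coef (w : seq nat) : algA C :=
  \prod_(i <- w) (S1 * S2 ^+ i.-1).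

(* The k-th term of the Picard series, that is the integral of
   omega(s_k) ... omega(s_1), where omega = sum_i a_i t^i S_1 S_2^{i-1}; the
   product is expanded and the coefficient of t^n collects the words of k
   positive indices with sum n. *)
Definition picard_term a (k : nat) (x : R) : fps (algA C) :=
  Fps (fun n =>
    \sum_(w : k.-tuple 'I_n.+1 |
          (ord0 \notin w) && (\sum_(i <- w) nat_of_ord i == n)%N)
       iter_integral a (map val w) x *: word_coef (map val w)).

(* The sum over k of the Picard terms; only those with k <= n contribute to the
   coefficient of t^n. *)
Definition fund_sol a (x : R) : fps (algA C) :=
  Fps (fun n => \sum_(k < n.+1) fpscoef (picard_term a k x) n).

Lemma fund_sol_coef0 a x : fpscoef (fund_sol a x) 0 = 1.
Proof.
rewrite /= big_ord1 (big_pred1 [tuple])/=.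
  by rewrite /word_coef big_nil scale1r.
by move=> w; rewrite tuple0 big_nil /=; apply/esym/eqP.
Qed.

Lemma fund_sol_unit a x : fund_sol a x \is a GRing.unit.
Proof. exact/fps_unit_coef0/fund_sol_coef0. Qed.

Definition monodromy a (n : int) : fps_group (algA C) :=
  exist _ (fund_sol a (n%:~R * (pi *+ 2))) (fund_sol_unit a _).

Definition trivial_monodromy a : Prop := forall n : int, monodromy a n = 1%g.

End CenterProblem.

(* Main.v *)
Require Import Defs.
From mathcomp Require Import all_boot all_order all_algebra.
From mathcomp Require Import -(notations) monalg.
From mathcomp Require Import complex all_classical all_reals all_analysis.
From mathcomp Require Import measurable_realfun ess_sup_inf.
From mathcomp Require Import zify ring lra.

(* Along a solution of the scalar equation, v(x)^m = v_0^m + m sum_i int_0^x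
   a_i v^(m+i).  Iterating this identity, v(x)^m = sum_n G_(n,m)(x) v_0^(m+n),
   where G_(n,m) = sum_w q_w(m) I_w runs over the compositions w of n, I_w is the
   iterated integral of w, and q_(i::w)(m) = m q_w(m + i).

   The algebra A(S_1, S_2) acts on functions of m by (S_1 g)(m) = m g(m + 1) and
   (S_2 g)(m) = g(m + 1).  The word (S_1 S_2^(i_k - 1)) ... (S_1 S_2^(i_1 - 1))
   maps the constant function 1 to q_w, so applying the coefficient of t^n in F(x)
   to 1 gives m |-> G_(n,m)(x).  A homogeneous element of degree n is a combination
   of the S_2^(n-b) S_1^b, which map 1 to polynomials in m of distinct degrees;
   hence F(x) = I iff G_(n,m)(x) = 0 for all n, m >= 1.

   The remainder of the expansion truncated at order N is O((c |v_0|)^(m+N+1)),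
   uniformly in N up to geometric factors.  If all G_(n,m)(2 pi) vanish, letting
   N tend to infinity gives v(2 pi) = v_0 for small v_0.  Conversely, in the case
   of a center, letting v_0 tend to 0 shows by induction on n that
   G_(n,m)(2 pi) = 0; small solutions exist by Picard iteration. *)

Set Implicit Arguments.
Unset Strict Implicit.
Unset Printing Implicit Defensive.

Import Order.TTheory GRing.Theory Num.Theory.
Import numFieldNormedType.Exports.

Local Open Scope ring_scope.

(** * The algebra A(S_1, S_2) *)

(** All powers of v have to be expanded together. Integrating a_i v^(m+i) raises the exponent by i
    and leaves only order N - i to be expanded, so the remainders form a triangular system along
    which m + N is constant. An exponential majorant of rate 2 (m + N) closes this system. The rate
    grows with N, but at time T = 2 pi it costs only one factor e^(2 T) per order, which small
    initial values absorb. Solutions are merely Lipschitz and satisfy the equation almost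
    everywhere. The remainders are therefore controlled by a mean value inequality for Lipschitz
    functions whose derivative is known almost everywhere, obtained from difference quotients.
    Smallness always enters through the product l * rho, where rho bounds v: the term a_i v^(i+1) is
    then at most rho (l rho)^i. Real and imaginary parts are estimated separately, at the cost of
    factors 2 in the constants. *)

Section NormalForm.
Variables (K : comNzRingType) (B : algType K) (s1 s2 : B).
Hypothesis s1s2_rel : s1 * s2 - s2 * s1 = - s2 ^+ 2.

Definition homogeneous n (x : B) : Prop := exists c : nat -> K,
  x = \sum_(b < n.+1) c b *: (s2 ^+ (n - b) * s1 ^+ b).

Lemma homogeneousD n (x y : B) : homogeneous n x -> homogeneous n y ->
  homogeneous n (x + y).
Proof.
move=> [c ->] [d ->]; exists (fun b => c b + d b).
by rewrite -big_split; apply: eq_bigr => b _; rewrite scalerDl.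
Qed.

Lemma homogeneous0 n : homogeneous n 0.
Proof.
by exists (fun=> 0); rewrite big1// => b _; rewrite scale0r.
Qed.

Lemma homogeneousZ n a (x : B) : homogeneous n x -> homogeneous n (a *: x).
Proof.
move=> [c ->]; exists (fun b => a * c b).
by rewrite scaler_sumr; apply: eq_bigr => b _; rewrite scalerA.
Qed.

Lemma homogeneous_sum n (I : eqType) (r : seq I) (F : I -> B) :
  (forall i, i \in r -> homogeneous n (F i)) ->
  homogeneous n (\sum_(i <- r) F i).
Proof.
elim: r => [|i r IHr] hF; first by rewrite big_nil; exact: homogeneous0.
rewrite big_cons; apply: homogeneousD; first by apply: hF; rewrite mem_head.
by apply: IHr => j jr; apply: hF; rewrite inE jr orbT.
Qed.

Lemma homogeneous_basis a b : homogeneous (a + b) (s2 ^+ a * s1 ^+ b).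
Proof.
exists (fun k => (k == b)%:R).
have bab : (b < (a + b).+1)%N by rewrite ltnS leq_addl.
rewrite (bigD1 (Ordinal bab))//= eqxx scale1r addnK big1 ?addr0// => k.
by rewrite -val_eqE/= => /negbTE ->; rewrite scale0r.
Qed.

(** The commutator with S_1 is a derivation that sends S_2 to - S_2^2, hence S_2^a to - a S_2^(a+1).
    This rule moves S_1 to the right of the S_2. *)
Lemma S1_S2X a : s1 * s2 ^+ a = s2 ^+ a * s1 - a%:R *: s2 ^+ a.+1 :> B.
Proof.
elim: a => [|a IHa]; first by rewrite !expr0 mulr1 mul1r scale0r subr0.
have S1S2 : s1 * s2 = s2 * s1 - s2 ^+ 2 :> B.
  by rewrite -s1s2_rel addrC subrK.
rewrite [in LHS]exprS [LHS]mulrA S1S2 mulrBl -[s2 * s1 * _]mulrA IHa mulrBr.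
rewrite [s2 * (_ * s1)]mulrA -scalerAr -!exprS.
by rewrite -exprD add2n -addrA -opprD -[a.+1%:R]natr1 scalerDl scale1r.
Qed.

Lemma homogeneousS1 n x : homogeneous n x -> homogeneous n.+1 (s1 * x).
Proof.
move=> [c ->]; rewrite mulr_sumr; apply: homogeneous_sum => b _.
rewrite -scalerAr; apply: homogeneousZ.
rewrite mulrA S1_S2X mulrBl -mulrA -exprS.
have bn : (b <= n)%N by rewrite -ltnS.
apply: homogeneousD.
  by have := homogeneous_basis (n - b) b.+1; rewrite addnS subnK.
rewrite -scalerAl -scaleNr; apply: homogeneousZ.
by have := homogeneous_basis (n - b).+1 b; rewrite addSn subnK.
Qed.

Lemma homogeneousS2 n x : homogeneous n x -> homogeneous n.+1 (s2 * x).
Proof.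
move=> [c ->]; rewrite mulr_sumr; apply: homogeneous_sum => b _.
rewrite -scalerAr; apply: homogeneousZ; rewrite mulrA -exprS.
have bn : (b <= n)%N by rewrite -ltnS.
by have := homogeneous_basis (n - b).+1 b; rewrite addSn subnK.
Qed.

End NormalForm.

(** * Action of the algebra on functions of m *)

Section Representation.
Variable K : comNzRingType.
Notation A := (algA K).
Implicit Types (x y : free2 K) (g h : nat -> K) (m : nat).

(** [ord0] stands for S_1, the other letter for S_2. With these operators the relator multiplies g(m
    + 2) by m - (m + 1) + 1 = 0. *)
Definition letter_op (i : 'I_2) g : nat -> K :=
  fun m => if i == ord0 then m%:R * g m.+1 else g m.+1.

Definition letters_op (w : seq 'I_2) g : nat -> K := foldr letter_op g w.

Definition free_op x g m : K :=
  mmap idfun (fun k : fmonom 'I_2 => letters_op (fmonom_val k) g m) x.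

(** Linearity in the function lets [free_opM] pull the coefficients of the right factor through the
    words of the left one. *)
Lemma letters_op_sum (I : Type) (r : seq I) (c : I -> K) (h : I -> nat -> K) w m :
  letters_op w (fun m => \sum_(i <- r) c i * h i m) m =
  \sum_(i <- r) c i * letters_op w (h i) m.
Proof.
elim: w m => //= i w IHw m; rewrite /letter_op; case: ifP => _; rewrite IHw//.
by rewrite mulr_sumr; apply: eq_bigr => j _; rewrite mulrCA.
Qed.

Lemma free_opD x y g m : free_op (x + y) g m = free_op x g m + free_op y g m.
Proof. exact: mmapD. Qed.

Lemma free_opN x g m : free_op (- x) g m = - free_op x g m.
Proof. exact: mmapN. Qed.

Lemma free_op0 g m : free_op 0 g m = 0.
Proof. exact: mmap0. Qed.

Lemma free_op_sum (I : Type) (r : seq I) (F : I -> free2 K) g m :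
  free_op (\sum_(i <- r) F i) g m = \sum_(i <- r) free_op (F i) g m.
Proof.
elim/big_ind2 : _ => [|x y u v <- <-|//]; first exact: free_op0.
exact: free_opD.
Qed.

Lemma free_opU c k g m : free_op (mkmalgU k c) g m = c * letters_op (fmonom_val k) g m.
Proof. exact: mmapU. Qed.

Lemma free_opM x y g m : free_op (x * y) g m = free_op x (free_op y g) m.
Proof.
rewrite [x * y]malgME free_op_sum [RHS]mmapE; apply: eq_bigr => k _.
rewrite free_op_sum.
under [X in _ = _ * letters_op _ X _]eq_fun do rewrite /free_op mmapE.
rewrite letters_op_sum mulr_sumr; apply: eq_bigr => l _.
by rewrite free_opU mulrA fmM /letters_op foldr_cat.
Qed.

Lemma free_opZ c x g m : free_op (c *: x) g m = c * free_op x g m.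
Proof.
rewrite -mul_malgC [LHS]free_opM /malgC free_opU.
by rewrite fm1.
Qed.

Lemma free_op_cst0 x m : free_op x (fun=> 0) m = 0.
Proof.
rewrite /free_op mmapE big1// => k _.
rewrite (_ : letters_op _ _ _ = 0) ?mulr0//.
elim: (fmonom_val k) m => //= i w IHw m.
by rewrite /letter_op; case: ifP => _; rewrite IHw ?mulr0.
Qed.

Lemma free_opS1 g m : free_op (freeS1 K) g m = m%:R * g m.+1.
Proof. by rewrite free_opU fmU /= /letter_op/= mul1r. Qed.

Lemma free_opS2 g m : free_op (freeS2 K) g m = g m.+1.
Proof. by rewrite free_opU fmU /= /letter_op/= mul1r. Qed.

(* The three products are evaluated separately: rewriting with [free_opM] in the
   relator makes unification unfold distinct products of generators. *)
Lemma free_op_relator g m : free_op (relator K) g m = 0.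
Proof.
have E1 : free_op (freeS1 K * freeS2 K) g m = m%:R * g m.+2.
  by rewrite free_opM free_opS1 free_opS2.
have E2 : free_op (freeS2 K * freeS1 K) g m = m.+1%:R * g m.+2.
  by rewrite free_opM free_opS2 free_opS1.
have E3 : free_op (freeS2 K ^+ 2) g m = g m.+2.
  by rewrite -[_ ^+ 2]/(freeS2 K * freeS2 K) free_opM !free_opS2.
have E : free_op (relator K) g m = free_op (freeS1 K * freeS2 K) g m
    - free_op (freeS2 K * freeS1 K) g m + free_op (freeS2 K ^+ 2) g m.
  exact: etrans (free_opD _ _ _ _) (congr1 (+%R^~ _)
    (etrans (free_opD _ _ _ _) (congr1 (+%R _) (free_opN _ _ _)))).
apply: etrans E (etrans (congr2 +%R (congr2 (fun a b => a - b) E1 E2) E3) _).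
by rewrite -natr1; ring.
Qed.

(** In a summand p.1 * r * p.2 the relator r annihilates the function produced by p.2, and p.1 maps
    the zero function to itself. *)
Lemma free_op_ideal x g m : x \in ideal2 (relator K) -> free_op x g m = 0.
Proof.
move=> /asboolP[s ->]; rewrite free_op_sum big1// => p _.
rewrite !free_opM -[RHS](free_op_cst0 p.1 m); congr (free_op _ _ _).
by apply: funext => n; rewrite free_op_relator.
Qed.

Definition alg_op (x : A) : (nat -> K) -> nat -> K := free_op (repr x).

(** The chosen representative differs from x by an element of the ideal, so [alg_op] does not depend
    on the choice. *)
Lemma alg_op_proj2 x g m : alg_op (proj2 _ x) g m = free_op x g m.
Proof.
have /(free_op_ideal g m) := repr_proj2 (relator K) x.
by rewrite free_opD free_opN => /eqP; rewrite subr_eq0 => /eqP.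
Qed.

Lemma alg_opD (x y : A) g m : alg_op (x + y) g m = alg_op x g m + alg_op y g m.
Proof.
rewrite -[x in LHS]proj2_repr -[y in LHS]proj2_repr -proj2D alg_op_proj2.
exact: free_opD.
Qed.

Lemma alg_op0 g m : alg_op 0 g m = 0.
Proof. by rewrite -(proj2_0 (relator K)) alg_op_proj2 free_op0. Qed.

Lemma alg_opZ c (x : A) g m : alg_op (c *: x) g m = c * alg_op x g m.
Proof.
rewrite -[x in LHS]proj2_repr -proj2Z alg_op_proj2.
exact: free_opZ.
Qed.

Lemma alg_opM (x y : A) g m : alg_op (x * y) g m = alg_op x (alg_op y g) m.
Proof.
rewrite -[x in LHS]proj2_repr -[y in LHS]proj2_repr -proj2M alg_op_proj2.
exact: free_opM.
Qed.

Lemma alg_op1 g m : alg_op 1 g m = g m.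
Proof.
rewrite -proj2_1 alg_op_proj2 free_opU.
by rewrite fm1 /= mul1r.
Qed.

Lemma alg_op_sum (I : Type) (r : seq I) (F : I -> A) g m :
  alg_op (\sum_(i <- r) F i) g m = \sum_(i <- r) alg_op (F i) g m.
Proof.
elim/big_ind2 : _ => [|x y u v <- <-|//]; first exact: alg_op0.
exact: alg_opD.
Qed.

Lemma alg_opS1 g m : alg_op S1 g m = m%:R * g m.+1.
Proof. by rewrite alg_op_proj2 free_opU fmU /= /letter_op/= mul1r. Qed.

Lemma alg_opS2X k g m : alg_op (S2 ^+ k) g m = g (m + k)%N.
Proof.
elim: k m => [|k IHk] m; first by rewrite expr0 alg_op1 addn0.
rewrite exprS alg_opM alg_op_proj2 free_opU fmU /= /letter_op/= mul1r.
by rewrite IHk addSnnS.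
Qed.

(** A rising factorial is monic of degree k in m; this separates the normally ordered monomials of a
    given degree. *)
Lemma alg_opS1X k m : alg_op (S1 ^+ k) (fun=> 1) m = \prod_(i < k) (m + i)%:R.
Proof.
elim: k m => [|k IHk] m; first by rewrite expr0 alg_op1 big_ord0.
rewrite exprS alg_opM alg_opS1 IHk big_ord_recl addn0; congr (_ * _).
by apply: eq_bigr => i _; rewrite addSnnS.
Qed.

(** [word_coef] with an arbitrary ring of scalars. *)
Definition word_product (w : seq nat) : A :=
  \prod_(i <- w) (S1 * S2 ^+ i.-1).

(** This is q_w(m) of the overview. *)
Fixpoint word_val (w : seq nat) m : K :=
  if w is i :: w' then m%:R * word_val w' (m + i)%N else 1.

(** A letter i multiplies by m and shifts by 1 + (i - 1) = i. For i = 0 the truncated predecessor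
    would still give a shift by 1, hence the exclusion of 0. *)
Lemma alg_op_word_coef w m : 0%N \notin w ->
  alg_op (word_product w) (fun=> 1) m = word_val w m.
Proof.
elim: w m => [|i w IHw] m.
  by rewrite /word_product big_nil alg_op1.
rewrite inE negb_or => /andP[i0 w0]; rewrite /word_product big_cons alg_opM.
rewrite alg_opM alg_opS1 alg_opS2X IHw//=; congr (_ * word_val _ _).
by case: i i0 => //= i _; rewrite addSnnS.
Qed.

Lemma homogeneous_word_coef w : 0%N \notin w ->
  homogeneous S1 S2 (sumn w) (word_product w).
Proof.
elim: w => [_|i w IHw].
  have := homogeneous_basis (@S1 K) S2 0 0; rewrite !expr0 mulr1 /=.
  by rewrite /word_product big_nil.
rewrite inE negb_or => /andP[i0 w0]; rewrite /word_product big_cons.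
case: i i0 => //= i _; rewrite addSn -mulrA; apply: (homogeneousS1 (@S1S2_rel K)).
elim: i => [|i IHi]; first by rewrite expr0 mul1r; exact: IHw.
by rewrite exprS -mulrA addSn; apply: homogeneousS2.
Qed.

End Representation.

(** * Faithfulness of the action on homogeneous elements *)

Section Faithful.
Variable K : numFieldType.

(** Only the polynomial of highest degree contributes to the top coefficient, so its scalar
    vanishes; induction then removes it. *)
Lemma monic_free (c : nat -> K) (P : nat -> {poly K}) n :
  (forall b, P b \is monic) -> (forall b, size (P b) = b.+1) ->
  \sum_(b < n) c b *: P b = 0 -> forall b, (b < n)%N -> c b = 0.
Proof.
move=> mP sP; elim: n => // n IHn; rewrite big_ord_recr/= => s0.
have cn : c n = 0.
  move/(congr1 (fun p : {poly K} => p`_n)): s0.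
  rewrite coefD coef_sum big1 => [|b _]; last first.
    by rewrite coefZ nth_default ?mulr0// sP.
  rewrite add0r coefZ coef0.
  have -> : (P n)`_n = 1.
    by have /monicP := mP n; rewrite lead_coefE sP.
  by rewrite mulr1.
move: s0; rewrite cn scale0r addr0 => /IHn IH b.
by rewrite ltnS leq_eqVlt => /predU1P[->//|/IH].
Qed.

Lemma homogeneous_eq0 n (x : algA K) : homogeneous S1 S2 n x ->
  (forall m, (0 < m)%N -> alg_op x (fun=> 1) m = 0) -> x = 0.
Proof.
move=> [c ->] x0.
(* The value of [P b] at m is that of the image of 1 under S_2^(n-b) S_1^b: a rising factorial
   shifted by n - b. *)
pose P b : {poly K} := \prod_(i < b) ('X - (- (n - b + i)%:R)%:P).
have mP b : P b \is monic by exact: monic_prod_XsubC.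
have sP b : size (P b) = b.+1.
  by rewrite /P size_prod_XsubC /index_enum -enumT size_enum_ord.
have P0 : \sum_(b < n.+1) c b *: P b = 0.
  apply/eqP; apply: contraT => /max_poly_roots.
  set p := \sum_(b < n.+1) _.
  (* The integers 1, ..., [size p] would be too many roots; they are distinct in K because the
     characteristic is 0. *)
  move=> /(_ [seq k.+1%:R | k <- iota 0 (size p)]).
  rewrite size_map size_iota ltnn => /(_ _ _) H.
  suff: false by []; apply: H.
    apply/allP => _ /mapP[k _ ->]; apply/rootP.
    rewrite -[RHS](x0 k.+1)// alg_op_sum horner_sum; apply: eq_bigr => b _.
    rewrite alg_opZ alg_opM alg_opS2X alg_opS1X hornerZ horner_prod.
    congr (_ * _); apply: eq_bigr => i _.
    by rewrite !hornerE opprK -natrD addnA.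
  rewrite map_inj_uniq ?iota_uniq// => i j /eqP.
  by rewrite eqr_nat => /eqP[].
have c0 := monic_free mP sP P0.
by rewrite big1// => b _; rewrite c0 ?scale0r.
Qed.

End Faithful.

Local Open Scope classical_set_scope.
Local Open Scope complex_scope.

(** * Oriented integrals and Lipschitz functions *)

Section OrientedIntegral.
Variable R : realType.
Notation mu := (@lebesgue_measure R).
Implicit Types f g : R -> R.

Lemma aeS (P Q : R -> Prop) : (forall x, P x -> Q x) ->
  {ae mu, forall x, P x} -> {ae mu, forall x, Q x}.
Proof. by apply: filterS; exact: (ae_filter_ringOfSetsType mu). Qed.

Lemma ae_and (P Q : R -> Prop) : {ae mu, forall x, P x} ->
  {ae mu, forall x, Q x} -> {ae mu, forall x, P x /\ Q x}.
Proof.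
by move=> HP HQ; apply: (filterS2 _ _ HP HQ);
  [exact: (ae_filter_ringOfSetsType mu)|].
Qed.

(** Measurable and locally bounded functions are closed under products, translations and [oint], and
    are integrable on every segment; a single side condition thus serves all the integrals below. *)
Definition mlbounded f :=
  measurable_fun [set: R] f /\
  forall M : R, exists K : R, forall x : R, `|x| <= M -> `|f x| <= K.

Lemma mlboundedD f g : mlbounded f -> mlbounded g ->
  mlbounded (fun x => f x + g x).
Proof.
move=> [mf bf] [mg bg]; split; first exact: measurable_funD.
move=> M; have [K Kf] := bf M; have [K' Kg] := bg M.
exists (K + K') => x xM; rewrite (le_trans (ler_normD _ _))//.
by rewrite lerD ?Kf ?Kg.
Qed.

Lemma mlboundedM f g : mlbounded f -> mlbounded g ->
  mlbounded (fun x => f x * g x).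
Proof.
move=> [mf bf] [mg bg]; split; first exact: measurable_funM.
move=> M; have [K Kf] := bf M; have [K' Kg] := bg M.
exists (K * K') => x xM; rewrite normrM.
by rewrite ler_pM ?Kf ?Kg.
Qed.

Lemma mlbounded_cst (c : R) : mlbounded (fun=> c).
Proof. by split; [exact: measurable_cst|move=> M; exists `|c|]. Qed.

Lemma mlboundedN f : mlbounded f -> mlbounded (fun x => - f x).
Proof.
move=> [mf bf]; split; first exact: measurableT_comp.
by move=> M; have [K Kf] := bf M; exists K => x xM; rewrite normrN Kf.
Qed.

Lemma mlboundedB f g : mlbounded f -> mlbounded g ->
  mlbounded (fun x => f x - g x).
Proof. by move=> ? /mlboundedN; exact: mlboundedD. Qed.

Lemma mlbounded_shift f c : mlbounded f -> mlbounded (fun x => f (x + c)).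
Proof.
move=> [mf bf]; split.
  by apply: (measurableT_comp mf); exact: measurable_funD.
move=> M; have [K Kf] := bf (M + `|c|); exists K => x xM.
by rewrite Kf// (le_trans (ler_normD _ _))// lerD.
Qed.

(** Local Lipschitz continuity gives measurability through continuity, and local bounds by
    comparison with f 0. *)
Lemma mlbounded_lipschitz f :
  (forall M : R, exists K : R, forall x y : R, `|x| <= M -> `|y| <= M ->
     `|f x - f y| <= K * `|x - y|) -> mlbounded f.
Proof.
move=> Lf; split; last first.
  move=> M; have [M0|M0] := leP 0 M; last first.
    by exists 0 => x xM; have := normr_ge0 x; lra.
  have [K fK] := Lf M; exists (`|K| * M + `|f 0|) => x xM.
  rewrite -[f x](subrK (f 0)) (le_trans (ler_normD _ _))// lerD2r.
  rewrite (le_trans (fK _ 0 _ _)) ?normr0// subr0.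
  by rewrite (le_trans (ler_wpM2r (normr_ge0 _) (ler_norm K)))// ler_wpM2l.
apply: continuous_measurable_fun => x; have [K fK] := Lf (`|x| + 1).
apply/cvgrPdist_le => e e0.
near=> y; rewrite (le_trans (fK _ _ _ _))//; first lra.
  near: y; apply: filterS (nbhsx_ballx x 1 ltr01) => y /=.
  rewrite /ball/= => xy; rewrite -[y](subKr x).
  by rewrite (le_trans (ler_normB _ _))// lerD2l ltW// distrC.
rewrite (@le_trans _ _ ((`|K| + 1) * `|x - y|))//.
  by rewrite ler_wpM2r// (le_trans (ler_norm K))// lerDl.
have K1 : 0 < `|K| + 1 by rewrite ltr_wpDl.
rewrite mulrC -ler_pdivlMr// ltW//; near: y.
by apply: (nbhsx_ballx x (e / (`|K| + 1))); rewrite divr_gt0.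
Unshelve. all: by end_near. Qed.

Lemma mlbounded_integrable f a b : mlbounded f ->
  mu.-integrable `[a, b] (EFin \o f).
Proof.
move=> [mf bf]; have [K Kf] := bf (`|a| + `|b|).
apply: measurable_bounded_integrable => //.
- rewrite /= lebesgue_measure_itv/=; case: ifPn => // _.
  by rewrite -EFinB ltry.
- exact: measurable_funTS.
exists K; split; first exact: num_real.
move=> M KM x /=; rewrite in_itv/= => /andP[ax xb].
rewrite (le_trans (Kf _ _)) ?(ltW KM)//.
have [x0|x0] := leP 0 x.
  by rewrite ger0_norm// (le_trans xb)// (le_trans (ler_norm b))// lerDr.
rewrite ltr0_norm// (@le_trans _ _ (- a)) ?lerN2//.
by rewrite (@le_trans _ _ `|a|)// ?lerDl// -normrN ler_norm.
Qed.

(** The real counterpart of [cintegral0], whose two components are values of [oint]. *)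
Definition oint f x : R :=
  if 0 <= x then \int[mu]_(t in `[0, x]) f t else - \int[mu]_(t in `[x, 0]) f t.

Lemma Rintegral_split f a b c : mlbounded f -> a <= b -> b <= c ->
  \int[mu]_(t in `[a, c]) f t =
  \int[mu]_(t in `[a, b]) f t + \int[mu]_(t in `[b, c]) f t.
Proof.
move=> mf ab bc.
have /= := @Rintegral_itvB R f (BLeft a) (BRight c) b
  (mlbounded_integrable _ _ mf).
rewrite !bnd_simp => /(_ ab bc) E.
rewrite -[LHS](subrK (\int[mu]_(t in `[a, b]) f t)) E addrC; congr (_ + _).
rewrite Rintegral_itv_obnd_cbnd//.
apply: integrableS (mlbounded_integrable b c mf) => //.
exact: subset_itv_oc_cc.
Qed.

Lemma oint0 f : oint f 0 = 0.
Proof. by rewrite /oint lexx set_itv1 Rintegral_set1. Qed.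

Lemma oint_itv f a b : mlbounded f -> a <= b ->
  oint f b - oint f a = \int[mu]_(t in `[a, b]) f t.
Proof.
move=> mf ab; rewrite /oint.
have [a0|a0] := leP 0 a; have [b0|b0] := leP 0 b; last 3 first.
- by have := le_lt_trans ab b0; lra.
- by rewrite (Rintegral_split mf (ltW a0) b0) opprK addrC.
- by rewrite (Rintegral_split mf ab (ltW b0)); lra.
by rewrite (Rintegral_split mf a0 ab); lra.
Qed.

Lemma ointE f x : mlbounded f -> 0 <= x ->
  oint f x = \int[mu]_(t in `[0, x]) f t.
Proof. by move=> mf x0; rewrite /oint x0. Qed.

Lemma ointD f g x : mlbounded f -> mlbounded g ->
  oint (fun t => f t + g t) x = oint f x + oint g x.
Proof.
move=> mf mg; rewrite /oint; case: ifPn => _; rewrite RintegralD ?opprD//;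
  exact: mlbounded_integrable.
Qed.

Lemma ointZ f c x : mlbounded f -> oint (fun t => c * f t) x = c * oint f x.
Proof.
move=> mf; rewrite /oint; case: ifPn => _; rewrite RintegralZl ?mulrN//;
  exact: mlbounded_integrable.
Qed.

Lemma ointN f x : mlbounded f -> oint (fun t => - f t) x = - oint f x.
Proof.
move=> mf; rewrite -mulN1r -ointZ//; congr (oint _ x).
by apply/funext => t; rewrite mulN1r.
Qed.

Lemma ointB f g x : mlbounded f -> mlbounded g ->
  oint (fun t => f t - g t) x = oint f x - oint g x.
Proof. by move=> mf mg; rewrite ointD ?ointN//; exact: mlboundedN. Qed.

Lemma oint_cst (c x : R) : oint (fun=> c) x = c * x.
Proof.
have itvE (a b : R) : a <= b -> fine (mu `[a, b]) = b - a.
  move=> ab; rewrite lebesgue_measure_itv/= lte_fin; case: ltgtP ab => //.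
  by move=> ->; rewrite subrr.
rewrite /oint; case: leP => x0; rewrite Rintegral_cst// itvE ?subr0//.
  by rewrite sub0r mulrN opprK.
exact: ltW.
Qed.

Lemma oint_le f g a b : mlbounded f -> mlbounded g -> a <= b ->
  (forall x, a <= x <= b -> f x <= g x) ->
  oint f b - oint f a <= oint g b - oint g a.
Proof.
move=> mf mg ab fg; rewrite !oint_itv//.
by apply: le_Rintegral => //; exact: mlbounded_integrable.
Qed.

Lemma oint_norm_le f g a b : mlbounded f -> mlbounded g -> a <= b ->
  (forall x, a <= x <= b -> `|f x| <= g x) ->
  `|oint f b - oint f a| <= oint g b - oint g a.
Proof.
move=> mf mg ab fg; rewrite ler_norml; apply/andP; split.
  rewrite lerNl; have -> : - (oint f b - oint f a) =
      oint (fun t => - f t) b - oint (fun t => - f t) a.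
    by rewrite !ointN// opprB opprK addrC.
  apply: oint_le => //; first exact: mlboundedN.
  by move=> x /fg; apply: le_trans; rewrite -normrN ler_norm.
by apply: oint_le => // x /fg; apply: le_trans; exact: ler_norm.
Qed.

Lemma oint_lipschitz_itv f K a b : mlbounded f -> a <= b ->
  (forall x, a <= x <= b -> `|f x| <= K) -> `|oint f b - oint f a| <= K * (b - a).
Proof.
move=> mf ab fK.
have := oint_norm_le mf (mlbounded_cst K) ab fK.
by rewrite !oint_cst -mulrBr.
Qed.

Lemma oint_lipschitz f M : mlbounded f -> exists K : R, forall x y : R,
  `|x| <= M -> `|y| <= M -> `|oint f x - oint f y| <= K * `|x - y|.
Proof.
move=> mf; have [K Kf] := mf.2 M; exists K => x y.
wlog xy : x y / x <= y.
  move=> H xM yM; have [|/ltW] := leP x y; first by move/H; exact.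
  by move=> yx; rewrite distrC (distrC x) H.
move=> xM yM.
have /andP[x1 x2] : - M <= x <= M by rewrite -ler_norml.
have /andP[y1 y2] : - M <= y <= M by rewrite -ler_norml.
rewrite distrC (distrC x) [`|y - x|]ger0_norm ?subr_ge0//.
apply: oint_lipschitz_itv => // z /andP[xz zy].
by apply: Kf; rewrite ler_norml (le_trans x1)// (le_trans zy).
Qed.

Lemma mlbounded_oint f : mlbounded f -> mlbounded (oint f).
Proof. by move=> mf; apply: mlbounded_lipschitz => M; exact: oint_lipschitz. Qed.

(** By uniqueness of Lebesgue measure it suffices to compare the lengths of half-open intervals. *)
Lemma lebesgue_measure_shift (c : R) (A : set R) : measurable A ->
  pushforward mu (fun x : R => x + c : measurableTypeR R) A = mu A.
Proof.
have mc : measurable_fun [set: R] (fun x : R => x + c).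
  by apply: measurable_funD; [exact: measurable_id|exact: measurable_cst].
move=> mA; apply/esym/lebesgue_measure_unique => //= _ [[a b]] _ <-.
rewrite /pushforward.
rewrite (_ : _ @^-1` _ = `]a - c, b - c]%classic); last first.
  by apply/seteqP; split => x /=; rewrite !in_itv/= ltrBlDr lerBrDr.
rewrite !lebesgue_measure_itv/= !lte_fin ltrD2r.
by case: ifP => // _; rewrite -!EFinB; congr (_%:E); lra.
Qed.

(** This change of variables serves twice: for the difference quotients in [lipschitz_nondecreasing]
    and for the periodicity argument in [flow_coef_shift]. *)
Lemma oint_shift f c x : mlbounded f ->
  oint f (x + c) = oint f c + oint (fun t => f (t + c)) x.
Proof.
move=> mf; have mfc := mlbounded_shift c mf.
have mc : measurable_fun [set: R] (fun x : R => x + c).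
  by apply: measurable_funD; [exact: measurable_id|exact: measurable_cst].
have shiftE a b : \int[mu]_(t in `[a + c, b + c]) f t =
    \int[mu]_(t in `[a, b]) f (t + c).
  rewrite /Rintegral; congr fine.
  have preE : (fun x : R => x + c) @^-1` `[a + c, b + c] = `[a, b]%classic.
    by apply/seteqP; split => y /=; rewrite !in_itv/= !lerD2r.
  transitivity
    (\int[pushforward mu (fun x : R => (x + c)%R : measurableTypeR R)]_(t in
      `[(a + c)%R, (b + c)%R]) (f t)%:E)%E.
    apply: eq_measure_integral => A mA _; apply/esym.
    exact: lebesgue_measure_shift.
  rewrite (@integral_pushforward _ _ (measurableTypeR R) (measurableTypeR R) R
    (fun x : R => x + c) mc mu _ (EFin \o f)).
  - by rewrite preE.
  - by apply/measurable_EFinP; exact: mf.1.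
  - rewrite preE; exact: (mlbounded_integrable a b mfc).
  - exact: measurable_itv.
have [x0|/ltW x0] := leP 0 x.
  have := oint_itv mf (lerD x0 (lexx c)); rewrite shiftE -oint_itv// add0r.
  rewrite oint0 subr0 => /= E.
  have -> : oint (fun t => f (t + c)) x = oint f (x + c) - oint f c.
    exact/esym/E.
  by rewrite [RHS]addrC subrK.
have := oint_itv mf (lerD x0 (lexx c)); rewrite shiftE -oint_itv// add0r.
by rewrite oint0 sub0r; lra.
Qed.

(** For x > 0 the oriented integral is, near x, the plain integral from 0, to which Lebesgue
    differentiation applies. *)
Lemma oint_derive f : mlbounded f ->
  {ae mu, forall x : R, 0 < x -> is_derive x 1 (oint f) (f x)}.
Proof.
move=> mf.
have mfi y := mlbounded_integrable 0 y mf.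
pose F x := (\int[mu]_(t in `[0, x]) f t).
have locf : locally_integrable [set: R] f.
  split; [exact: mf.1|exact: openT|move=> K _ cK].
  have [M [_ KM]] := compact_bounded cK.
  have mK : measurable K by exact: compact_measurable.
  have Ksub : K `<=` `[- (M + 1), M + 1].
    by move=> x Kx /=; rewrite in_itv/= -ler_norml; apply: KM => //; lra.
  have := mlbounded_integrable (- (M + 1)) (M + 1) mf.
  move=> /integrableP[mf' ]; apply: le_lt_trans.
  apply: ge0_subset_integral => //=.
  apply/measurable_EFinP; apply: measurableT_comp => //.
  exact: measurable_funTS mf.1.
have := FTC1 (a := BLeft 0) mfi locf.
apply: aeS => x /= H x0.
have x0E : (0%:E < x%:E)%E by rewrite lte_fin.
have [d1 d2] := H x0E.
have dF : is_derive x 1 F (f x).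
  apply: DeriveDef; first exact: d1.
  by rewrite -derive1E.
have FE : \near x, F x = oint f x.
  near=> y; rewrite ointE//.
  by apply: ltW; near: y; exact: lt_nbhsr.
exact: near_eq_is_derive FE dF.
Unshelve. all: by end_near. Qed.

(** The integral of the difference quotients over [0, X] is a difference of averages of g near X and
    near 0, so it tends to g X - g 0. Since the quotients have nonnegative limits almost everywhere,
    this limit is nonnegative. *)
Lemma lipschitz_nondecreasing g (L X : R) : 0 <= X ->
  (forall x y : R, `|g x - g y| <= L * `|x - y|) ->
  {ae mu, forall x : R, 0 < x < X -> exists2 d : R, 0 <= d & is_derive x 1 g d} ->
  g 0 <= g X.
Proof.
move=> X0 gL dg.
have mg : mlbounded g.
  by apply: mlbounded_lipschitz => M; exists L => x y _ _; exact: gL.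
pose e n : R := n.+1%:R^-1.
have e0 n : 0 < e n by rewrite invr_gt0.
pose q n x := n.+1%:R * (g (x + e n) - g x).
have qL n x : `|q n x| <= L.
  rewrite normrM ger0_norm ?ler0n// -ler_pdivlMl ?ltr0Sn// mulrC.
  by rewrite (le_trans (gL _ _))// addrAC subrr add0r (gtr0_norm (e0 n)).
have mq n : mlbounded (q n).
  apply: mlboundedM; first exact: mlbounded_cst.
  by apply: mlboundedB => //; exact: mlbounded_shift.
have L0 : 0 <= L.
  by have := gL 1 0; rewrite subr0 normr1 mulr1; apply: le_trans.
(* After translation the integrals over the common part cancel, leaving the averages of g over
   [X, X + e n] and [0, e n]. Each differs from its endpoint value by at most L * e n. *)
have qE n : oint (q n) X <= g X - g 0 + 2 * L * e n.
  rewrite /q ointZ; last first.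
    by apply: mlboundedB => //; exact: mlbounded_shift.
  rewrite ointB//; last exact: mlbounded_shift.
  rewrite (_ : oint (fun t => g (t + e n)) X = oint g (X + e n) - oint g (e n));
    last by rewrite oint_shift// addrAC subrr add0r.
  rewrite -(ler_pM2l (e0 n)) mulrA mulVf ?pnatr_eq0// mul1r.
  have itvcst (c : R) a : c * e n = oint (fun=> c) (a + e n) - oint (fun=> c) a.
    by rewrite !oint_cst; ring.
  have gLe a x : a <= x <= a + e n -> `|g x - g a| <= L * e n.
    move=> /andP[ax xe]; rewrite (le_trans (gL _ _))//.
    by rewrite ler_wpM2l// ger0_norm; lra.
  have H1 : oint g (X + e n) - oint g X <= (g X + L * e n) * e n.
    rewrite (itvcst _ X); apply: oint_le => //; first exact: mlbounded_cst.
      by rewrite lerDl ltW.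
    by move=> x /gLe; rewrite ler_norml; lra.
  have H2 : (g 0 - L * e n) * e n <= oint g (0 + e n) - oint g 0.
    rewrite (itvcst _ 0); apply: oint_le => //; first exact: mlbounded_cst.
      by rewrite lerDl ltW.
    by move=> x /gLe; rewrite ler_norml; lra.
  move: H1 H2; rewrite oint0 add0r; lra.
(* The negative parts of the difference quotients tend to 0 almost everywhere
   and are dominated by the Lipschitz constant. *)
pose h n x := Num.max 0 (- q n x).
have h0 n x : 0 <= h n x by rewrite /h le_max lexx.
have hL n x : h n x <= L.
  rewrite /h ge_max L0/=; have := qL n x.
  by rewrite ler_norml lerNl => /andP[].
have mh n : mlbounded (h n).
  split; last by move=> M; exists L => x _; rewrite ger0_norm.
  apply: measurable_maxr; first exact: measurable_cst.
  exact: (mlboundedN (mq n)).1.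
have hE n : - oint (h n) X <= oint (q n) X.
  have hq x : 0 <= x <= X -> - h n x <= q n x.
    by move=> _; rewrite lerNl /h le_max lexx orbT.
  have := oint_le (mlboundedN (mh n)) (mq n) X0 hq.
  by rewrite !oint0 !subr0 ointN.
have qh : {ae mu, forall x, `[0, X]%classic x -> h ^~ x @ \oo --> (0 : R)}.
  have nz : {ae mu, forall x : R, x != 0 /\ x != X}.
    exists [set 0; X]; split; first exact: measurableU.
      by apply/countable_lebesgue_measure0/finite_set_countable.
    move=> x /= /not_andP[|] /negP; rewrite negbK => /eqP ->; [by left|by right].
  apply: (aeS _ (ae_and nz dg)) => x [[x0' xX'] dgx] /=.
  rewrite in_itv/= => /andP[x0 xX].
  have [|d d0 {}dgx] := dgx.
    by rewrite !lt_neqAle eq_sym x0' x0 xX' xX.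
  have qd : q ^~ x @ \oo --> d.
    have dq : (fun k => k^-1 *: (g (k *: 1 + x) - g x)) @ 0^' --> d.
      by rewrite -(@derive_val _ _ _ x 1 g d dgx); exact: ex_derive.
    have /cvg_at_rightP/(_ e) := cvg_dnbhs_at_right dq.
    have e_cvg : e n @[n --> \oo] --> 0 by exact: cvg_harmonic.
    move=> /(_ (conj e0 e_cvg)); apply: cvg_trans.
    apply: near_eq_cvg; apply: nearW => n /=.
    by rewrite /q /e invrK -[_ *: 1]/(_ * 1) mulr1 [_ + x]addrC.
  have cmax : {for d, continuous (fun y : R => Num.max 0 (- y))}.
    apply: (@continuous_max R R (fun=> 0) -%R d); first exact: cst_continuous.
    exact: opp_continuous.
  have := continuous_cvg _ cmax qd.
  by rewrite max_l ?oppr_le0//; exact.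
have := @dominated_convergence _ _ R mu `[0, X]%classic
  (measurable_itv _) (fun n => EFin \o h n) (cst 0%E) (fun=> L%:E).
have mhD n : measurable_fun `[0, X] (EFin \o h n).
  by apply/measurable_EFinP; exact: measurable_funTS (mh n).1.
have hcvg : {ae mu, forall x, `[0, X]%classic x ->
    (fun n => (EFin \o h n) x) @ \oo --> cst 0%E x}.
  apply: (aeS _ qh) => x H Xx.
  by apply: cvg_EFin; [exact: nearW|exact: H].
move=> /(_ mhD (measurable_cst _) hcvg (mlbounded_integrable _ _ (mlbounded_cst _))).
case.
  by apply: aeW => x n _ /=; rewrite lee_fin ger0_norm.
move=> _ _; rewrite integral0 => int0.
have oh0 : oint (h n) X @[n --> \oo] --> 0.
  have -> : (fun n => oint (h n) X) =
      (fun n => fine (\int[mu]_(x in `[0%R, X]) (h n x)%:E)%E).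
    by apply/funext => n; rewrite ointE.
  exact: fine_cvg int0.
have e_cvg : e n @[n --> \oo] --> 0 by exact: cvg_harmonic.
have : (fun n => g X - g 0 + 2 * L * e n + oint (h n) X) @ \oo -->
    g X - g 0 + 2 * L * 0 + 0.
  by apply: cvgD => //; apply: cvgD; [exact: cvg_cst|apply: cvgMr].
rewrite mulr0 !addr0 => lim0.
rewrite -subr_ge0 -(cvg_lim (@Rhausdorff R) lim0).
apply: limr_ge; first by apply/cvg_ex; eexists; exact: lim0.
apply: nearW => n; rewrite -lerBlDr sub0r.
exact: le_trans (hE n) (qE n).
Unshelve. all: by end_near. Qed.

(** Composing with the 1-Lipschitz retraction [c] onto [0, X] extends g to the line with the same
    constant and does not affect derivatives at interior points. *)
Lemma lipschitz_itv_nondecreasing g (L X : R) : 0 <= X ->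
  (forall x y : R, 0 <= x <= X -> 0 <= y <= X -> `|g x - g y| <= L * `|x - y|) ->
  {ae mu, forall x : R, 0 < x < X -> exists2 d : R, 0 <= d & is_derive x 1 g d} ->
  g 0 <= g X.
Proof.
move=> X0 gL dg; pose c x : R := Num.max 0 (Num.min x X).
have cI x : 0 <= c x <= X by rewrite le_max lexx ge_max X0 ge_min lexx orbT.
have cid x : 0 <= x <= X -> c x = x.
  by move=> /andP[x0 xX]; rewrite /c min_l// max_r.
have cL x y : `|c x - c y| <= `|x - y|.
  by rewrite /c; case: (leP x X) => ?; case: (leP y X) => ?;
    rewrite ?(max_r X0); case: (leP 0 x) => ?; case: (leP 0 y) => ?;
    rewrite ler_norml; case: (ler0P (x - y)); lra.
have L0 : (0 < X) -> 0 <= L.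
  move=> Xp; have := gL X 0; rewrite !lexx X0 => /(_ isT isT).
  move=> gX; have := le_trans (normr_ge0 _) gX.
  by rewrite subr0 (ger0_norm X0) pmulr_lge0.
have [->//|Xn0] := eqVneq X 0.
have Xp : 0 < X by rewrite lt_neqAle eq_sym Xn0.
have := @lipschitz_nondecreasing (g \o c) L X X0.
rewrite /= !cid ?lexx ?X0//; apply.
  by move=> x y; rewrite (le_trans (gL _ _ _ _))// ler_wpM2l ?L0.
apply: (aeS _ dg) => x dgx x0X; have [d d0 {}dgx] := dgx x0X; exists d => //.
apply: near_eq_is_derive dgx; case/andP: x0X => x0 xX.
near=> y; rewrite /= cid//; apply/andP; split; apply: ltW; near: y.
  exact: lt_nbhsr.
exact: lt_nbhsl.
Unshelve. all: by end_near. Qed.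

(** Both phi + g and phi - g are nondecreasing, since their derivatives are nonnegative almost
    everywhere. *)
Lemma lipschitz_mean_value g phi dphi (L L' X : R) : 0 <= X ->
  (forall x y : R, 0 <= x <= X -> 0 <= y <= X -> `|g x - g y| <= L * `|x - y|) ->
  (forall x y : R, 0 <= x <= X -> 0 <= y <= X ->
     `|phi x - phi y| <= L' * `|x - y|) ->
  (forall x : R, 0 < x < X -> is_derive x 1 phi (dphi x)) ->
  {ae mu, forall x : R, 0 < x < X ->
     exists2 d : R, `|d| <= dphi x & is_derive x 1 g d} ->
  `|g X - g 0| <= phi X - phi 0.
Proof.
move=> X0 gL phiL dphiE dg; rewrite ler_norml; apply/andP; split.
  have : phi 0 + g 0 <= phi X + g X; last by lra.
  apply: (@lipschitz_itv_nondecreasing (fun x => phi x + g x) (L' + L)) => //.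
    move=> x y x0 y0; rewrite opprD addrACA (le_trans (ler_normD _ _))//.
    by rewrite mulrDl lerD ?gL ?phiL.
  apply: (aeS _ dg) => x dgx x0; have [d dle {}dgx] := dgx x0.
  have dp := dphiE _ x0; exists (dphi x + d); last exact: is_deriveD.
  by move: dle; rewrite ler_norml; lra.
have : phi 0 - g 0 <= phi X - g X; last by lra.
apply: (@lipschitz_itv_nondecreasing (fun x => phi x - g x) (L' + L)) => //.
  move=> x y x0 y0.
  have -> : phi x - g x - (phi y - g y) = (phi x - phi y) - (g x - g y) by ring.
  by rewrite (le_trans (ler_normB _ _))// mulrDl lerD ?phiL ?gL.
apply: (aeS _ dg) => x dgx x0; have [d dle {}dgx] := dgx x0.
have dp := dphiE _ x0; exists (dphi x - d); last exact: is_deriveB.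
by move: dle; rewrite ler_norml; lra.
Qed.

End OrientedIntegral.

(** * Complex-valued functions *)

Section Norm1.
Variable R : realType.
Notation C := R[i].
Implicit Types z w : C.

(* Unlike the modulus, this submultiplicative norm is controlled componentwise,
   so that bounds on integrals follow from the real case. *)
Definition norm1 z : R := `|complex.Re z| + `|complex.Im z|.

Lemma complex_ReD z w : complex.Re (z + w) = complex.Re z + complex.Re w.
Proof. by case: z w => [a b] [c d]. Qed.

Lemma complex_ImD z w : complex.Im (z + w) = complex.Im z + complex.Im w.
Proof. by case: z w => [a b] [c d]. Qed.

Lemma complex_ReN z : complex.Re (- z) = - complex.Re z.
Proof. by case: z. Qed.

Lemma complex_ImN z : complex.Im (- z) = - complex.Im z.
Proof. by case: z. Qed.

Lemma complex_ReM z w : complex.Re (z * w) =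
  complex.Re z * complex.Re w - complex.Im z * complex.Im w.
Proof. by case: z w => [a b] [c d]. Qed.

Lemma complex_ImM z w : complex.Im (z * w) =
  complex.Re z * complex.Im w + complex.Im z * complex.Re w.
Proof. by case: z w => [a b] [c d]. Qed.

Lemma complex_ReB z w : complex.Re (z - w) = complex.Re z - complex.Re w.
Proof. by rewrite complex_ReD complex_ReN. Qed.

Lemma complex_ImB z w : complex.Im (z - w) = complex.Im z - complex.Im w.
Proof. by rewrite complex_ImD complex_ImN. Qed.

Lemma eqC z w : complex.Re z = complex.Re w -> complex.Im z = complex.Im w ->
  z = w.
Proof. by case: z w => [a b] [c d] /= -> ->. Qed.

Lemma norm1_ge0 z : 0 <= norm1 z.
Proof. exact: addr_ge0. Qed.

Lemma norm10 : norm1 0 = 0.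
Proof. by rewrite /norm1 /= normr0 addr0. Qed.

Lemma norm11 : norm1 1 = 1.
Proof. by rewrite /norm1 /= normr0 normr1 addr0. Qed.

Lemma norm1_real (x : R) : norm1 x%:C = `|x|.
Proof. by rewrite /norm1 /= normr0 addr0. Qed.

Lemma norm1D z w : norm1 (z + w) <= norm1 z + norm1 w.
Proof.
by rewrite /norm1 complex_ReD complex_ImD addrACA lerD ?ler_normD.
Qed.

Lemma norm1N z : norm1 (- z) = norm1 z.
Proof. by rewrite /norm1 complex_ReN complex_ImN !normrN. Qed.

Lemma norm1B z w : norm1 (z - w) <= norm1 z + norm1 w.
Proof. by rewrite (le_trans (norm1D _ _))// norm1N. Qed.

Lemma dist1C z w : norm1 (z - w) = norm1 (w - z).
Proof. by rewrite -norm1N opprB. Qed.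

Lemma norm1M z w : norm1 (z * w) <= norm1 z * norm1 w.
Proof.
rewrite /norm1 complex_ReM complex_ImM mulrDl !mulrDr -!normrM.
rewrite (le_trans (lerD (ler_normB _ _) (ler_normD _ _)))//.
by rewrite -!addrA lerD2l addrC -!addrA lerD2l addrC.
Qed.

Lemma norm1_eq0 z : norm1 z = 0 -> z = 0.
Proof.
move/eqP; rewrite paddr_eq0// !normr_eq0 => /andP[/eqP a /eqP b].
exact: eqC.
Qed.

Lemma norm1X z n : norm1 (z ^+ n) <= norm1 z ^+ n.
Proof.
elim: n => [|n IHn]; first by rewrite !expr0 norm11.
by rewrite !exprS (le_trans (norm1M _ _))// ler_wpM2l ?norm1_ge0.
Qed.

Lemma norm1_natr n : norm1 n%:R = n%:R.
Proof.
suff -> : (n%:R : C) = (n%:R)%:C by rewrite norm1_real ger0_norm.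
by rewrite (rmorph_nat (real_complex R)).
Qed.

Lemma norm1_sum (I : Type) (r : seq I) (P : pred I) (F : I -> C) :
  norm1 (\sum_(i <- r | P i) F i) <= \sum_(i <- r | P i) norm1 (F i).
Proof.
elim/big_rec2: _ => [|i x y _ H]; first by rewrite norm10.
by rewrite (le_trans (norm1D _ _))// lerD2l.
Qed.

Lemma normc_le_norm1 z : Normc.normc z <= norm1 z.
Proof.
case: z => a b; rewrite /norm1 /=.
rewrite -[leRHS]ger0_norm ?addr_ge0// -sqrtr_sqr ler_wsqrtr//.
rewrite sqrrD -[X in X + _ <= _]real_normK ?num_real//.
rewrite -[X in _ + X <= _](real_normK (num_real b)) addrAC lerDl.
by rewrite mulrn_wge0// mulr_ge0.
Qed.

Lemma norm1_le_normc z : norm1 z <= 2 * Normc.normc z.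
Proof.
case: z => a b; rewrite /norm1 /= mulrDl mul1r.
have le_sqrt (x y : R) : `|x| <= Num.sqrt (x ^+ 2 + y ^+ 2).
  by rewrite -sqrtr_sqr ler_wsqrtr// lerDl sqr_ge0.
by rewrite lerD ?le_sqrt// addrC le_sqrt.
Qed.

Lemma norm1_subX z w (rho : R) n : norm1 z <= rho -> norm1 w <= rho ->
  norm1 (z ^+ n.+1 - w ^+ n.+1) <= n.+1%:R * rho ^+ n * norm1 (z - w).
Proof.
move=> zr wr; have r0 : 0 <= rho by exact: le_trans (norm1_ge0 _) zr.
rewrite subrXX (le_trans (norm1M _ _))// mulrC ler_wpM2r ?norm1_ge0//.
rewrite (le_trans (norm1_sum _ _ _))//.
rewrite (@le_trans _ _ (\sum_(i < n.+1) rho ^+ n))//.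
  apply: ler_sum => i _; rewrite (le_trans (norm1M _ _))//.
  rewrite -[in leRHS](subnK (leq_ord i)) exprD.
  by rewrite ler_pM ?norm1_ge0// (le_trans (norm1X _ _))// ?subSS
    lerXn2r ?nnegrE ?norm1_ge0.
by rewrite sumr_const card_ord mulr_natl.
Qed.

End Norm1.

Section ComplexOriented.
Variable R : realType.
Notation C := R[i].
Notation mu := (@lebesgue_measure R).
Notation N1 := (@norm1 R).
Implicit Types f g : R -> C.

Definition cmlbounded f :=
  mlbounded (fun x => complex.Re (f x)) /\ mlbounded (fun x => complex.Im (f x)).

Lemma cmlboundedD f g : cmlbounded f -> cmlbounded g ->
  cmlbounded (fun x => f x + g x).
Proof.
move=> [f1 f2] [g1 g2]; split.
  by under eq_fun do rewrite complex_ReD; exact: mlboundedD.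
by under eq_fun do rewrite complex_ImD; exact: mlboundedD.
Qed.

Lemma cmlboundedB f g : cmlbounded f -> cmlbounded g ->
  cmlbounded (fun x => f x - g x).
Proof.
move=> [f1 f2] [g1 g2]; split.
  by under eq_fun do rewrite complex_ReB; exact: mlboundedB.
by under eq_fun do rewrite complex_ImB; exact: mlboundedB.
Qed.

Lemma cmlboundedM f g : cmlbounded f -> cmlbounded g ->
  cmlbounded (fun x => f x * g x).
Proof.
move=> [f1 f2] [g1 g2]; split.
  by under eq_fun do rewrite complex_ReM; apply: mlboundedB; exact: mlboundedM.
by under eq_fun do rewrite complex_ImM; apply: mlboundedD; exact: mlboundedM.
Qed.

Lemma cmlbounded_cst (c : C) : cmlbounded (fun=> c).
Proof. by split; exact: mlbounded_cst. Qed.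

Lemma cmlboundedX f n : cmlbounded f -> cmlbounded (fun x => f x ^+ n).
Proof.
move=> cf; elim: n => [|n IHn].
  by under eq_fun do rewrite expr0; exact: cmlbounded_cst.
by under eq_fun do rewrite exprS; exact: cmlboundedM.
Qed.

Lemma cmlbounded_sum (I : eqType) (r : seq I) (F : I -> R -> C) :
  (forall i, i \in r -> cmlbounded (F i)) ->
  cmlbounded (fun x => \sum_(i <- r) F i x).
Proof.
elim: r => [|i r IHr] cF.
  by under eq_fun do rewrite big_nil; exact: cmlbounded_cst.
under eq_fun do rewrite big_cons.
apply: cmlboundedD; first by apply: cF; rewrite mem_head.
by apply: IHr => j jr; apply: cF; rewrite inE jr orbT.
Qed.

Lemma cmlbounded_norm1 f :
  measurable_fun [set: R] (fun x => complex.Re (f x)) ->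
  measurable_fun [set: R] (fun x => complex.Im (f x)) ->
  (exists K : R, forall x, N1 (f x) <= K) -> cmlbounded f.
Proof.
move=> mr mi [K fK]; split; split=> // M; exists K => x _;
  by rewrite (le_trans _ (fK x))// /norm1 ?lerDl ?lerDr.
Qed.

Lemma cintegral0E f x : cintegral0 f x =
  oint (fun t => complex.Re (f t)) x +i* oint (fun t => complex.Im (f t)) x.
Proof. by rewrite /cintegral0 /cintegral /oint; case: ifPn. Qed.

Lemma cintegral00 f : cintegral0 f 0 = 0.
Proof. by rewrite cintegral0E !oint0. Qed.

Lemma cintegral0D f g x : cmlbounded f -> cmlbounded g ->
  cintegral0 (fun t => f t + g t) x = cintegral0 f x + cintegral0 g x.
Proof.
move=> [f1 f2] [g1 g2]; rewrite !cintegral0E.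
under [X in oint X x +i* _]eq_fun do rewrite complex_ReD.
under [X in _ +i* oint X x]eq_fun do rewrite complex_ImD.
by rewrite !ointD.
Qed.

Lemma cintegral0Z f c x : cmlbounded f ->
  cintegral0 (fun t => c * f t) x = c * cintegral0 f x.
Proof.
move=> [f1 f2]; rewrite !cintegral0E; case: c => a b.
under [X in oint X x +i* _]eq_fun do rewrite complex_ReM.
under [X in _ +i* oint X x]eq_fun do rewrite complex_ImM.
have z (g : R -> R) c : mlbounded g -> mlbounded (fun t => c * g t).
  by move=> mg; apply: mlboundedM => //; exact: mlbounded_cst.
by rewrite ointB ?ointD//= ?ointZ//; exact: z.
Qed.

Lemma cintegral0_cst (c : C) (x : R) : cintegral0 (fun=> c) x = c * x%:C.
Proof.
rewrite cintegral0E !oint_cst; case: c => a b /=.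
by apply: eqC; rewrite /= ?complex_ReM ?complex_ImM /= !mulr0 ?subr0 ?add0r.
Qed.

Lemma cintegral0_sum (I : eqType) (r : seq I) (F : I -> R -> C) x :
  (forall i, i \in r -> cmlbounded (F i)) ->
  cintegral0 (fun t => \sum_(i <- r) F i t) x =
  \sum_(i <- r) cintegral0 (F i) x.
Proof.
elim: r => [|i r IHr] cF.
  rewrite big_nil; under [X in cintegral0 X]eq_fun do rewrite big_nil.
  by rewrite cintegral0_cst mul0r.
have cr : forall j, j \in r -> cmlbounded (F j).
  by move=> j jr; apply: cF; rewrite inE jr orbT.
rewrite big_cons; under [X in cintegral0 X]eq_fun do rewrite big_cons.
rewrite cintegral0D ?IHr//; last exact: cmlbounded_sum.
by apply: cF; rewrite mem_head.
Qed.

Lemma cintegral0_shift f c x : cmlbounded f ->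
  cintegral0 f (x + c) = cintegral0 f c + cintegral0 (fun t => f (t + c)) x.
Proof.
move=> [f1 f2]; rewrite !cintegral0E (oint_shift _ _ f1) (oint_shift _ _ f2).
by [].
Qed.

Lemma cmlbounded_cintegral0 f : cmlbounded f -> cmlbounded (cintegral0 f).
Proof.
move=> [f1 f2]; split; under eq_fun do rewrite cintegral0E /=;
  exact: mlbounded_oint.
Qed.

(** Each component of f is bounded by K separately, hence the factor 2. *)
Lemma cintegral0_lipschitz_itv f (K a b : R) : cmlbounded f -> a <= b ->
  (forall x, a <= x <= b -> N1 (f x) <= K) ->
  N1 (cintegral0 f b - cintegral0 f a) <= 2 * K * (b - a).
Proof.
move=> [f1 f2] ab fK; rewrite !cintegral0E /norm1 /=.
rewrite mulrAC mulrDl mul1r mulrC mulrDr lerD// oint_lipschitz_itv// => x /fK;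
  by apply: le_trans; rewrite /norm1 ?lerDl ?lerDr.
Qed.

Lemma cintegral0_lipschitz f (M : R) : cmlbounded f -> exists K : R,
  forall x y : R, `|x| <= M -> `|y| <= M ->
  N1 (cintegral0 f x - cintegral0 f y) <= K * `|x - y|.
Proof.
move=> [f1 f2]; have [K1 H1] := oint_lipschitz M f1.
have [K2 H2] := oint_lipschitz M f2; exists (K1 + K2) => x y xM yM.
by rewrite !cintegral0E /norm1 /= mulrDl lerD ?H1 ?H2.
Qed.

Lemma cintegral0_derive f : cmlbounded f ->
  {ae mu, forall x : R, 0 < x -> cis_derive (cintegral0 f) x (f x)}.
Proof.
move=> [f1 f2].
apply: (aeS _ (ae_and (oint_derive f1) (oint_derive f2))) => x [d1 d2] x0.
split; under eq_fun do rewrite cintegral0E /=; [exact: d1|exact: d2].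
Qed.

Lemma cis_deriveD f g x z w : cis_derive f x z -> cis_derive g x w ->
  cis_derive (fun y => f y + g y) x (z + w).
Proof.
move=> [f1 f2] [g1 g2]; split.
  by under eq_fun do rewrite complex_ReD; rewrite complex_ReD; exact: is_deriveD.
by under eq_fun do rewrite complex_ImD; rewrite complex_ImD; exact: is_deriveD.
Qed.

Lemma cis_deriveB f g x z w : cis_derive f x z -> cis_derive g x w ->
  cis_derive (fun y => f y - g y) x (z - w).
Proof.
move=> [f1 f2] [g1 g2]; split.
  by under eq_fun do rewrite complex_ReB; rewrite complex_ReB; exact: is_deriveB.
by under eq_fun do rewrite complex_ImB; rewrite complex_ImB; exact: is_deriveB.
Qed.

Lemma cis_derive_cst (c : C) (x : R) : cis_derive (fun=> c) x 0.
Proof. by split; exact: is_derive_cst. Qed.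

Lemma cis_deriveM f g x z w : cis_derive f x z -> cis_derive g x w ->
  cis_derive (fun y => f y * g y) x (f x * w + g x * z).
Proof.
move=> [f1 f2] [g1 g2]; split.
  under eq_fun do rewrite complex_ReM.
  apply: is_derive_eq (is_deriveB (is_deriveM f1 g1) (is_deriveM f2 g2)) _.
  by rewrite /GRing.scale/= complex_ReD !complex_ReM; ring.
under eq_fun do rewrite complex_ImM.
apply: is_derive_eq (is_deriveD (is_deriveM f1 g2) (is_deriveM f2 g1)) _.
by rewrite /GRing.scale/= complex_ImD !complex_ImM; ring.
Qed.

Lemma cis_deriveX f n x z : cis_derive f x z ->
  cis_derive (fun y => f y ^+ n.+1) x (n.+1%:R * f x ^+ n * z).
Proof.
move=> df; elim: n => [|n IHn].
  by under eq_fun do rewrite expr1; rewrite expr0 !mul1r.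
under eq_fun do rewrite exprS.
have -> : n.+2%:R * f x ^+ n.+1 * z =
    f x * (n.+1%:R * f x ^+ n * z) + f x ^+ n.+1 * z.
  by rewrite [n.+2%:R]mulrS exprS; ring.
exact: cis_deriveM.
Qed.

Lemma cis_derive_sum (I : eqType) (r : seq I) (F : I -> R -> C) (D : I -> C) x :
  (forall i, i \in r -> cis_derive (F i) x (D i)) ->
  cis_derive (fun y => \sum_(i <- r) F i y) x (\sum_(i <- r) D i).
Proof.
elim: r => [|i r IHr] cF.
  by under eq_fun do rewrite big_nil; rewrite big_nil; exact: cis_derive_cst.
under eq_fun do rewrite big_cons.
rewrite big_cons; apply: cis_deriveD; first by apply: cF; rewrite mem_head.
by apply: IHr => j jr; apply: cF; rewrite inE jr orbT.
Qed.

(** The majorant phi is used once for each component, hence again a factor 2. *)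
Lemma clipschitz_mean_value g phi dphi (L L' X : R) : 0 <= X ->
  (forall x y : R, 0 <= x <= X -> 0 <= y <= X -> N1 (g x - g y) <= L * `|x - y|) ->
  (forall x y : R, 0 <= x <= X -> 0 <= y <= X ->
     `|phi x - phi y| <= L' * `|x - y|) ->
  (forall x : R, 0 < x < X -> is_derive x 1 phi (dphi x)) ->
  {ae mu, forall x : R, 0 < x < X ->
     exists2 d : C, N1 d <= dphi x & cis_derive g x d} ->
  N1 (g X - g 0) <= 2 * (phi X - phi 0).
Proof.
move=> X0 gL phiL dphiE dg; rewrite /norm1 complex_ReB complex_ImB mulrDl mul1r.
apply: lerD.
  apply: (@lipschitz_mean_value R (fun x => complex.Re (g x)) phi dphi L L' X) => //.
    move=> x y x0 y0; rewrite -complex_ReB (le_trans _ (gL _ _ x0 y0))//.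
    by rewrite /norm1 lerDl.
  apply: (aeS _ dg) => x dgx x0; have [d dle [d1 d2]] := dgx x0.
  by exists (complex.Re d) => //; rewrite (le_trans _ dle)// /norm1 lerDl.
apply: (@lipschitz_mean_value R (fun x => complex.Im (g x)) phi dphi L L' X) => //.
  move=> x y x0 y0; rewrite -complex_ImB (le_trans _ (gL _ _ x0 y0))//.
  by rewrite /norm1 lerDr.
apply: (aeS _ dg) => x dgx x0; have [d dle [d1 d2]] := dgx x0.
by exists (complex.Im d) => //; rewrite (le_trans _ dle)// /norm1 lerDr.
Qed.

End ComplexOriented.

(** * Coefficients of the flow *)

Section Compositions.

(** The argument k is fuel: n - i is not a structural subterm of n. Any k >= n gives the same list,
    by [compositions_recE]. *)
Fixpoint compositions_rec k n : seq (seq nat) :=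
  if n is 0 then [:: [::]] else
  if k is k'.+1 then
    flatten [seq map (cons i) (compositions_rec k' (n - i)%N) | i <- iota 1 n]
  else [::].

Definition compositions n := compositions_rec n n.

Lemma compositions_recE k n : (n <= k)%N -> compositions_rec k n = compositions n.
Proof.
suff H k' l m : (m <= k')%N -> (m <= l)%N ->
    compositions_rec k' m = compositions_rec l m.
  by move=> nk; exact: H.
elim: k' l m => [|k' IHk] [|l] [|m]//= mk ml.
congr (_ ++ flatten _); first by rewrite (IHk l)//; lia.
by apply/eq_in_map => i; rewrite mem_iota => /andP[i2 im];
  rewrite (IHk l)//; lia.
Qed.

Lemma compositionsS n : compositions n.+1 =
  flatten [seq map (cons i) (compositions (n.+1 - i)%N) | i <- iota 1 n.+1].
Proof.
rewrite {1}/compositions -[LHS]/(flatten [seq map (cons i)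
  (compositions_rec n (n.+1 - i)%N) | i <- iota 1 n.+1]); congr flatten.
by apply/eq_in_map => i; rewrite mem_iota => /andP[i1 _];
  rewrite compositions_recE//; lia.
Qed.

Lemma mem_compositions n w : (w \in compositions n) = (0%N \notin w) && (sumn w == n).
Proof.
elim/ltn_ind: n w => -[|n] IHn w.
  rewrite inE; case: w => [|i w]//=.
  by rewrite eqE/= addn_eq0 inE; case: i => //=; rewrite andbF.
rewrite compositionsS; apply/flattenP/idP => [[_ /mapP[i + ->] /mapP[u + ->]]|].
  rewrite mem_iota => /andP[i1 im]; rewrite IHn/=; last by lia.
  by rewrite inE => /andP[u0 /eqP us]; rewrite negb_or u0 andbT; lia.
case: w => [|i w]; first by [].
rewrite inE negb_or -andbA => /and3P[i0 w0 /eqP/= s].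
exists [seq i :: v | v <- compositions (n.+1 - i)%N].
  rewrite -[X in _ \in X]/(map _ (iota 1 n.+1)).
  by apply/mapP; exists i => //; rewrite mem_iota; lia.
by apply/mapP; exists w => //; rewrite IHn ?w0/=; lia.
Qed.

Lemma uniq_compositions n : uniq (compositions n).
Proof.
elim/ltn_ind: n => -[|n] IHn//; rewrite compositionsS.
apply: (@allpairs_uniq_dep _ (fun=> _) _ (fun i (v : seq nat) => i :: v) (iota 1 n.+1)
  (fun i => compositions (n.+1 - i)%N)).
- exact: iota_uniq.
- by move=> i; rewrite mem_iota => /andP[i1 _]; apply: IHn; lia.
- by move=> [i u] [j v] /= _ _ [-> ->].
Qed.

Lemma sum_compositionsS (V : nmodType) (F : seq nat -> V) n :
  \sum_(w <- compositions n.+1) F w =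
  \sum_(i <- iota 1 n.+1) \sum_(w <- compositions (n.+1 - i)%N) F (i :: w).
Proof.
rewrite compositionsS big_flatten big_map; apply: eq_bigr => i _.
by rewrite big_map.
Qed.

Lemma size_le_sumn w : 0%N \notin w -> (size w <= sumn w)%N.
Proof.
elim: w => //= i w IHw; rewrite inE negb_or => /andP[i0 /IHw].
by lia.
Qed.

Lemma mem_le_sumn (w : seq nat) i : i \in w -> (i <= sumn w)%N.
Proof. by elim: w => //= j w IHw; rewrite inE => /predU1P[->|/IHw]; lia. Qed.

(** A composition of n has at most n parts, each at most n. The tuples over 'I_n.+1 of lengths 0 to
    n that occur in the Picard terms therefore list every composition exactly once. *)
Lemma sum_tuple_compositions (V : nmodType) (F : seq nat -> V) n :
  \sum_(k < n.+1) \sum_(w : k.-tuple 'I_n.+1 |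
     (ord0 \notin w) && (\sum_(i <- w) nat_of_ord i == n)%N) F (map val w) =
  \sum_(w <- compositions n) F w.
Proof.
have sumE (w : seq 'I_n.+1) : (\sum_(i <- w) nat_of_ord i)%N = sumn (map val w).
  by elim: w => [|i w IHw]; rewrite ?big_nil// big_cons IHw.
have ord0E (w : seq 'I_n.+1) : (ord0 \in w) = (0%N \in map val w).
  by rewrite -[0%N]/(val (@ord0 n)) mem_map//; exact: val_inj.
transitivity (\sum_(k < n.+1) \sum_(u <- compositions n | size u == k) F u).
  apply: eq_bigr => k _; rewrite -[RHS]big_filter.
  rewrite -[LHS]big_filter.
  rewrite -[LHS](big_map (fun w : k.-tuple 'I_n.+1 => map val (tval w)) xpredT F).
  apply: perm_big; apply: uniq_perm.
  - rewrite map_inj_uniq ?filter_uniq ?index_enum_uniq//.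
    move=> u v; move/(inj_map val_inj) => uv; exact: val_inj.
  - by rewrite filter_uniq// uniq_compositions.
  move=> u; rewrite mem_filter mem_compositions; apply/mapP/and3P.
    move=> [w]; rewrite mem_filter sumE ord0E => /andP[/andP[w0 ws] _] ->.
    by rewrite size_map size_tuple.
  move=> [/eqP uk u0 /eqP us].
  have ui i : i \in u -> (i < n.+1)%N by move/mem_le_sumn; rewrite us ltnS.
  pose w := map (@inord n) u.
  have wu : map val w = u.
    by rewrite -map_comp map_id_in// => i /ui iu /=; rewrite inordK.
  have wk : size w == k by rewrite size_map uk.
  exists (Tuple wk); last by [].
  by rewrite mem_filter sumE ord0E/= wu u0 us eqxx mem_index_enum.
rewrite (exchange_big_dep xpredT)//= [LHS]big_seq [RHS]big_seq; apply: eq_bigr => u.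
rewrite mem_compositions => /andP[/size_le_sumn un /eqP us].
move: un; rewrite us -ltnS => un.
by rewrite (big_pred1 (Ordinal un))// => k; rewrite -val_eqE /= eq_sym.
Qed.

End Compositions.

Section GSums.
Variable R : realType.
Notation C := R[i].
Variable a : nat -> R -> C.

(* The coefficient of v_0^(m+n) in the expansion of v(x)^m along a solution. *)
Definition flow_coef n m x : C :=
  \sum_(w <- compositions n) word_val C w m * iter_integral a w x.

Lemma fund_sol_coefE x n : fpscoef (fund_sol a x) n =
  \sum_(w <- compositions n) iter_integral a w x *: word_coef R w.
Proof.
exact: (sum_tuple_compositions (fun w => iter_integral a w x *: word_coef R w)).
Qed.

Lemma fund_sol_coef_eq0 x n : fpscoef (fund_sol a x) n = 0 <->
  forall m, (0 < m)%N -> flow_coef n m x = 0.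
Proof.
have opE m : alg_op (fpscoef (fund_sol a x) n) (fun=> 1) m = flow_coef n m x.
  rewrite fund_sol_coefE alg_op_sum [LHS]big_seq [RHS]big_seq; apply: eq_bigr => w.
  rewrite mem_compositions => /andP[w0 _].
  by rewrite alg_opZ alg_op_word_coef// mulrC.
split=> [F0 m _|G0]; first by rewrite -opE F0 alg_op0.
apply: (@homogeneous_eq0 _ n); last by move=> m /G0; rewrite -opE.
rewrite fund_sol_coefE; apply: homogeneous_sum => w.
rewrite mem_compositions => /andP[w0 /eqP <-]; apply: homogeneousZ.
exact: homogeneous_word_coef.
Qed.

(** The constant coefficient of F is always 1, so only the degrees n > 0 carry a condition. *)
Lemma trivial_monodromyE : trivial_monodromy a <->
  forall (k : int) n m, (0 < n)%N -> (0 < m)%N ->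
    flow_coef n m (k%:~R * (pi *+ 2)) = 0.
Proof.
split=> [F1 k n m n0|G0 k].
  move: m; apply/fund_sol_coef_eq0.
  have -> : fund_sol a (k%:~R * (pi *+ 2)) = 1.
    exact: (congr1 (fun g : fps_group (algA C) => sval g) (F1 k)).
  by case: n n0.
apply: val_inj; apply: fpsP => -[|n]; first exact: fund_sol_coef0.
rewrite [RHS]/=; apply/fund_sol_coef_eq0 => m m0; exact: G0.
Qed.

Hypothesis abnd : forall i, (0 < i)%N -> cmlbounded (a i).

Lemma cmlbounded_iter_integral w : 0%N \notin w -> cmlbounded (iter_integral a w).
Proof.
elim: w => [_|i w IHw]; first exact: cmlbounded_cst.
rewrite inE negb_or eq_sym -lt0n => /andP[i0 w0] /=.
by apply/cmlbounded_cintegral0/cmlboundedM; [exact: abnd|exact: IHw].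
Qed.

Lemma cmlbounded_flow_coef n m : cmlbounded (flow_coef n m).
Proof.
apply: cmlbounded_sum => w; rewrite mem_compositions => /andP[w0 _].
apply: cmlboundedM; first exact: cmlbounded_cst.
exact: cmlbounded_iter_integral.
Qed.

Lemma flow_coef0 m x : flow_coef 0 m x = 1.
Proof. by rewrite /flow_coef big_seq1 mul1r. Qed.

Lemma cmlbounded_flow_step i n m : (0 < i)%N ->
  cmlbounded (fun s => a i s * flow_coef n m s).
Proof.
by move=> i0; apply: cmlboundedM; [exact: abnd|exact: cmlbounded_flow_coef].
Qed.

(** Splitting off the first letter of w, which is the outermost integration, gives this recursion;
    differentiation and translation of the coefficients both go through it. *)
Lemma flow_coefS n m x : flow_coef n.+1 m x = \sum_(i <- iota 1 n.+1)
  m%:R * cintegral0 (fun s => a i s * flow_coef (n.+1 - i)%N (m + i)%N s) x.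
Proof.
rewrite /flow_coef sum_compositionsS [LHS]big_seq [RHS]big_seq.
apply: eq_bigr => i; rewrite mem_iota => /andP[i0 _].
have -> : (fun s => a i s * flow_coef (n.+1 - i)%N (m + i)%N s) = (fun s =>
    \sum_(w <- compositions (n.+1 - i)%N)
      word_val C w (m + i)%N * (a i s * iter_integral a w s)).
  apply/funext => s; rewrite mulr_sumr; apply: eq_bigr => w _.
  by rewrite mulrCA.
have cw w : w \in compositions (n.+1 - i)%N ->
    cmlbounded (fun s => a i s * iter_integral a w s).
  rewrite mem_compositions => /andP[w0 _].
  by apply: cmlboundedM; [exact: abnd|exact: cmlbounded_iter_integral].
rewrite cintegral0_sum; last first.
  by move=> w /cw; apply: cmlboundedM; exact: cmlbounded_cst.
rewrite mulr_sumr [LHS]big_seq [RHS]big_seq; apply: eq_bigr => w /cw cwi.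
by rewrite cintegral0Z//= mulrA.
Qed.

Lemma flow_coef_at0 n m : (0 < n)%N -> flow_coef n m 0 = 0.
Proof.
case: n => // n _; rewrite flow_coefS big1_seq// => i _.
by rewrite cintegral00 mulr0.
Qed.

(** In the recursion, the integral up to x + T splits into one up to T and a translated one up to x.
    The first parts add up to the coefficient at T, which is 0; the second are unchanged by
    periodicity and the induction hypothesis. *)
Lemma flow_coef_shift (T : R) : (forall i, (0 < i)%N -> periodic (a i) T) ->
  (forall n m, (0 < n)%N -> (0 < m)%N -> flow_coef n m T = 0) ->
  forall n m x, (0 < m)%N -> flow_coef n m (x + T) = flow_coef n m x.
Proof.
move=> aT G0; elim/ltn_ind => -[|n] IHn m x m0; first by rewrite !flow_coef0.
have := G0 n.+1 m isT m0; rewrite !flow_coefS => GT.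
rewrite -[RHS]add0r -[X in _ = X + _]GT {GT}.
rewrite -big_split [LHS]big_seq [RHS]big_seq.
apply: eq_bigr => i; rewrite mem_iota => /andP[i0 _].
rewrite cintegral0_shift; last exact: cmlbounded_flow_step.
rewrite mulrDr; apply: (congr2 +%R) => //.
congr (_ * cintegral0 _ x); apply/funext => s.
by rewrite aT// IHn//; lia.
Qed.

Lemma flow_coef_multiples (T : R) : (forall i, (0 < i)%N -> periodic (a i) T) ->
  (forall n m, (0 < n)%N -> (0 < m)%N -> flow_coef n m T = 0) ->
  forall (k : int) n m, (0 < n)%N -> (0 < m)%N -> flow_coef n m (k%:~R * T) = 0.
Proof.
move=> aT G0 k n m n0 m0; have sh := flow_coef_shift aT G0.
have H (j : nat) x : flow_coef n m (x + j%:R * T) = flow_coef n m x.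
  elim: j x => [|j IHj] x; first by rewrite mul0r addr0.
  by rewrite -natr1 mulrDl mul1r addrA sh.
case: k => j; first by rewrite -[_ * T]add0r H flow_coef_at0.
(* Adding j + 1 periods to this negative multiple leads to the point 0. *)
rewrite -(H j.+1) NegzE mulrNz mulNr addNr.
exact: flow_coef_at0.
Qed.

End GSums.

(** * Estimates for solutions *)

Section LipschitzOn.
Variable R : realType.
Notation C := R[i].
Notation N1 := (@norm1 R).
Variable X : R.
Implicit Types f g : R -> C.

Definition lipschitz1 f := exists L : R, forall x y : R,
  0 <= x <= X -> 0 <= y <= X -> N1 (f x - f y) <= L * `|x - y|.

Lemma lipschitz1_cst c : lipschitz1 (fun=> c).
Proof. by exists 0 => x y _ _; rewrite subrr norm10 mul0r. Qed.

Lemma lipschitz1D f g : lipschitz1 f -> lipschitz1 g ->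
  lipschitz1 (fun x => f x + g x).
Proof.
move=> [L Lf] [M Lg]; exists (L + M) => x y x0 y0.
rewrite opprD addrACA (le_trans (norm1D _ _))// mulrDl.
by rewrite lerD ?Lf ?Lg.
Qed.

Lemma lipschitz1Z c f : lipschitz1 f -> lipschitz1 (fun x => c * f x).
Proof.
move=> [L Lf]; exists (N1 c * L) => x y x0 y0.
rewrite -mulrBr (le_trans (norm1M _ _))// -mulrA.
by rewrite ler_wpM2l ?norm1_ge0 ?Lf.
Qed.

Lemma lipschitz1B f g : lipschitz1 f -> lipschitz1 g ->
  lipschitz1 (fun x => f x - g x).
Proof.
move=> Lf /(lipschitz1Z (-1)) Lg.
have := lipschitz1D Lf Lg; congr lipschitz1.
by apply/funext => x; rewrite mulN1r.
Qed.

Lemma lipschitz1_sum (I : eqType) (r : seq I) (F : I -> R -> C) :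
  (forall i, i \in r -> lipschitz1 (F i)) ->
  lipschitz1 (fun x => \sum_(i <- r) F i x).
Proof.
elim: r => [|i r IHr] cF.
  by under eq_fun do rewrite big_nil; exact: lipschitz1_cst.
under eq_fun do rewrite big_cons.
apply: lipschitz1D; first by apply: cF; rewrite mem_head.
by apply: IHr => j jr; apply: cF; rewrite inE jr orbT.
Qed.

Lemma lipschitz1_cintegral0 f : cmlbounded f -> lipschitz1 (cintegral0 f).
Proof.
move=> cf; have [K fK] := cintegral0_lipschitz X cf; exists K => x y.
by move=> /andP[x0 xX] /andP[y0 yX]; rewrite fK// ger0_norm.
Qed.

Lemma lipschitz1X f (rho : R) n : (forall x, 0 <= x <= X -> N1 (f x) <= rho) ->
  lipschitz1 f -> lipschitz1 (fun x => f x ^+ n.+1).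
Proof.
move=> fr [L Lf]; exists (n.+1%:R * rho ^+ n * L) => x y x0 y0.
have r0 : 0 <= rho by exact: le_trans (norm1_ge0 _) (fr _ x0).
rewrite (le_trans (norm1_subX n (fr _ x0) (fr _ y0)))// -[leRHS]mulrA.
by rewrite ler_wpM2l ?Lf// mulr_ge0// exprn_ge0.
Qed.

End LipschitzOn.

Section Estimates.
Variable R : realType.
Notation C := R[i].
Notation mu := (@lebesgue_measure R).
Notation N1 := (@norm1 R).
Notation T := (pi *+ 2 : R).
Variables (a : nat -> R -> C) (l : R).
Hypothesis l0 : 0 < l.
Hypothesis abnd : forall i, (0 < i)%N -> cmlbounded (a i).
Hypothesis al : forall i x, (0 < i)%N -> N1 (a i x) <= l ^+ i.

Lemma period_gt0 : 0 < T.
Proof. by rewrite mulrn_wgt0// pi_gt0. Qed.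

Lemma big_iotaE (F : nat -> C) N :
  \sum_(1 <= i < N.+1) F i = \sum_(i <- iota 1 N) F i.
Proof. by rewrite /index_iota subn1. Qed.

Lemma big_iota1S (V : nmodType) (F : nat -> V) N :
  \sum_(i <- iota 1 N.+1) F i = \sum_(i <- iota 1 N) F i + F N.+1.
Proof. by have := iotaD 1 N 1; rewrite addn1 => ->; rewrite big_cat/= big_seq1. Qed.

(** The i-th term is at most rho (l rho)^i, a geometric sequence of ratio at most 1 / 2, so a tail
    is at most twice its first term. *)
Lemma cseries_tail x w (rho : R) z N : N1 w <= rho -> l * rho <= 1 / 2 ->
  cseries_from1 (fun i => a i x * w ^+ i.+1) z ->
  N1 (z - \sum_(i <- iota 1 N) a i x * w ^+ i.+1) <= 2 * rho * (l * rho) ^+ N.+1.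
Proof.
move=> wr lr sz; have r0 : 0 <= rho by exact: le_trans (norm1_ge0 _) wr.
have lr0 : 0 <= l * rho by rewrite mulr_ge0// ltW.
pose S n := \sum_(i <- iota 1 n) a i x * w ^+ i.+1.
rewrite -/(S N).
have SS n : S n.+1 = S n + a n.+1 x * w ^+ n.+2.
  exact: big_iota1S.
have termle n : N1 (a n.+1 x * w ^+ n.+2) <= rho * (l * rho) ^+ n.+1.
  rewrite (le_trans (norm1M _ _))// exprMn mulrCA -exprS.
  rewrite ler_pM ?norm1_ge0 ?al// (le_trans (norm1X _ _))//.
  by rewrite lerXn2r ?nnegrE ?norm1_ge0.
(* The subtracted term makes the finite bound telescope, so that induction on k goes through. *)
have Sle k : N1 (S (N + k)%N - S N) <=
    2 * rho * (l * rho) ^+ N.+1 - 2 * rho * (l * rho) ^+ (N + k).+1.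
  elim: k => [|k IHk]; first by rewrite addn0 !subrr norm10.
  rewrite addnS SS addrAC (le_trans (norm1D _ _))//.
  rewrite (le_trans (lerD IHk (termle _)))//.
  rewrite [(l * rho) ^+ (N + k).+2]exprS.
  have := mulr_ge0 r0 (exprn_ge0 (N + k).+1 lr0).
  set p := (l * rho) ^+ (N + k).+1 => rp.
  suff : l * rho * (rho * p) <= 1 / 2 * (rho * p) by lra.
  by rewrite ler_wpM2r.
apply/ler_addgt0Pr => e e0.
(* Half of e, because passing from the modulus to [norm1] costs a factor 2. *)
move/cvgrPdist_lt : sz => /(_ (e / 2)) [|M _ HM]; first by rewrite divr_gt0.
have := HM (N + M)%N (leq_addl _ _) => /=; rewrite sub0r normrN.
rewrite big_iotaE -/(S _) ger0_norm; last first.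
  by case: (_ - _) => ? ? /=; exact: sqrtr_ge0.
move=> He; rewrite -(subrKA (S (N + M)%N)) addrC (le_trans (norm1D _ _))// lerD//.
  by rewrite (le_trans (Sle M))// gerBl mulr_ge0// ?exprn_ge0// mulr_ge0.
rewrite dist1C (le_trans (norm1_le_normc _))//.
by rewrite mulrC -ler_pdivlMr// ltW.
Qed.

Section Solution.
Variable v : R -> C.
Hypothesis sol : is_solution a v.
Variable rho : R.
Hypothesis rho0 : 0 < rho.
Hypothesis lrho : l * rho <= 1 / 2.

Lemma solution_lipschitz : lipschitz1 T v.
Proof.
have [[L Lv] _] := sol; exists (2 * L) => x y x0 y0.
rewrite (le_trans (norm1_le_normc _))// -mulrA ler_wpM2l//.
by apply: Lv; rewrite /= in_itv.
Qed.

(** The tail bound with N = 0 gives 2 rho (l rho) for v', and the mean value inequality doubles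
    it. *)
Lemma solution_increment X : 0 <= X <= T ->
  (forall x, 0 <= x <= X -> N1 (v x) <= rho) ->
  N1 (v X - v 0) <= 4 * rho * (l * rho) * X.
Proof.
move=> /andP[X0 XT] vr; have [L Lv] := solution_lipschitz.
pose K := 2 * rho * (l * rho).
have -> : 4 * rho * (l * rho) * X = 2 * (K * X - K * 0) by rewrite /K; ring.
have K0 : 0 <= K by rewrite /K !mulr_ge0// ltW.
apply: (@clipschitz_mean_value R v (fun x => K * x) (fun=> K) L K X) => //.
- move=> x y /andP[x0 xX] /andP[y0 yX].
  by apply: Lv; rewrite ?x0 ?y0 (le_trans _ XT).
- by move=> x y _ _; rewrite -mulrBr normrM (ger0_norm K0).
- move=> x _; apply: is_derive_eq.
  by rewrite /GRing.scale/= mulr1.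
have [_ dv] := sol; apply: (aeS _ dv) => x dvx /andP[x0 xX].
have [|z sz dz] := dvx.
  by rewrite in_itv/= (ltW x0) (le_trans (ltW xX)).
exists z => //; have vx : N1 (v x) <= rho by rewrite vr// !ltW.
by have := cseries_tail 0 vx lrho sz; rewrite big_nil subr0 expr1.
Qed.

(** A continuation argument in steps of fixed length: as long as v is bounded by rho up to k d, its
    increment from 0 is at most rho / 4, so it is at most rho / 2 at k d and cannot exceed rho
    before (k + 1) d. *)
Lemma solution_bound : N1 (v 0) <= rho / 4 -> 4 * (l * rho) * T <= 1 / 4 ->
  forall x, 0 <= x <= T -> N1 (v x) <= rho.
Proof.
move=> v0 lT; have [L' Lv'] := solution_lipschitz.
pose L := `|L'| + 1; have L0 : 0 < L by rewrite ltr_wpDl.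
have Lv x y : 0 <= x <= T -> 0 <= y <= T -> N1 (v x - v y) <= L * `|x - y|.
  move=> x0 y0; rewrite (le_trans (Lv' _ _ x0 y0))// ler_wpM2r//.
  by rewrite /L (le_trans (ler_norm L'))// lerDl.
(* Over a time d the solution moves by at most rho / 2, by its own Lipschitz constant. *)
pose d := rho / 2 / L; have d0 : 0 < d by rewrite !divr_gt0.
suff H k x : 0 <= x <= T -> x <= k%:R * d -> N1 (v x) <= rho.
  move=> x xT; apply: (H (Num.bound (x / d))) => //.
  rewrite -ler_pdivrMr// ltW// archi_boundP// divr_ge0 ?(ltW d0)//.
  by case/andP: xT.
elim: k x => [|k IHk] x /andP[x0 xT] xk.
  have -> : x = 0 by apply/eqP; rewrite eq_le x0 andbT (le_trans xk)// mul0r.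
  by rewrite (le_trans v0)// ler_pdivrMr// ler_peMr ?(ltW rho0)// ler1n.
have [xk'|kx] := leP x (k%:R * d); first by apply: IHk; rewrite ?x0.
have y0 : 0 <= k%:R * d by rewrite mulr_ge0// ltW.
have yT : k%:R * d <= T by rewrite (le_trans (ltW kx)).
have vy : N1 (v (k%:R * d)) <= rho / 2.
  rewrite -[v (k%:R * d)](subrK (v 0)) (le_trans (norm1D _ _))//.
  have := solution_increment (X := k%:R * d).
  rewrite y0 yT => /(_ isT) H.
  have {}H := H _; have : 4 * rho * (l * rho) * (k%:R * d) <= rho / 4.
    rewrite (_ : 4 * rho * _ * _ = rho * (4 * (l * rho) * (k%:R * d))); last by ring.
    rewrite ler_pM2l// -div1r (le_trans _ lT)// ler_wpM2l// !mulr_ge0//.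
    by rewrite ltW.
    by rewrite ltW.
  move=> H2; have := le_trans (H _) H2.
  move=> H3; rewrite (le_trans (lerD (H3 _) v0))//; last by lra.
  move=> u /andP[u0 uk]; apply: IHk => //.
  by rewrite u0 (le_trans uk).
rewrite -[v x](subrK (v (k%:R * d))) (le_trans (norm1D _ _))//.
rewrite (le_trans (lerD (Lv _ _ _ _) vy)) ?x0 ?y0//.
rewrite ger0_norm ?subr_ge0 ?(ltW kx)//.
suff : L * (x - k%:R * d) <= rho / 2 by lra.
rewrite mulrC -ler_pdivlMr// -/d lerBlDr addrC.
by move: xk; rewrite -natr1 mulrDl mul1r.
Qed.

Hypothesis vrho : forall x, 0 <= x <= T -> N1 (v x) <= rho.

Definition partial_flow m N x : C :=
  \sum_(0 <= n < N.+1) flow_coef a n m x * v 0 ^+ (m + n).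

Lemma partial_flow0 m x : partial_flow m 0 x = v 0 ^+ m.
Proof. by rewrite /partial_flow big_nat1 flow_coef0 mul1r addn0. Qed.

Lemma partial_flowS m N x : partial_flow m N.+1 x =
  partial_flow m N x + flow_coef a N.+1 m x * v 0 ^+ (m + N.+1).
Proof. by rewrite /partial_flow big_nat_recr. Qed.

Lemma partial_flow_at0 m N : partial_flow m N 0 = v 0 ^+ m.
Proof.
elim: N => [|N IHN]; first exact: partial_flow0.
by rewrite partial_flowS IHN flow_coef_at0// mul0r addr0.
Qed.

Lemma lipschitz1_flow_coef n m : lipschitz1 T (flow_coef a n m).
Proof.
case: n => [|n].
  have := lipschitz1_cst T (1 : C); congr lipschitz1.
  by apply/funext => x; rewrite flow_coef0.
rewrite (_ : flow_coef a n.+1 m = fun x => \sum_(i <- iota 1 n.+1) m%:R *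
  cintegral0 (fun s => a i s * flow_coef a (n.+1 - i) (m + i) s) x); last first.
  by apply/funext => x; exact: flow_coefS.
apply: lipschitz1_sum => i; rewrite mem_iota => /andP[i0 _].
exact/lipschitz1Z/lipschitz1_cintegral0/cmlbounded_flow_step.
Qed.

Lemma lipschitz1_partial_flow m N : lipschitz1 T (partial_flow m N).
Proof.
apply: lipschitz1_sum => n _.
under eq_fun do rewrite mulrC.
exact/lipschitz1Z/lipschitz1_flow_coef.
Qed.

(** The truncated form of (v^m)' = m sum_i a_i v^(m+i): the factor a_i comes with exponent m + i and
    order N - i. *)
Lemma partial_flow_derive : {ae mu, forall x : R, 0 < x -> forall m N,
  cis_derive (partial_flow m N) x
    (\sum_(i <- iota 1 N) m%:R * (a i x * partial_flow (m + i) (N - i) x))}.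
Proof.
(* A single null set for all indices, so that the induction on N can run at a fixed x. *)
have H : {ae mu, forall x i n m, 0 < x -> (0 < i)%N ->
    cis_derive (cintegral0 (fun s => a i s * flow_coef a n m s)) x
      (a i x * flow_coef a n m x)}.
  apply/ae_foralln => i; apply/ae_foralln => n; apply/ae_foralln => m.
  case: i => [|i]; first by apply: aeW.
  apply: (aeS _ (cintegral0_derive (cmlbounded_flow_step abnd n m (ltn0Sn i)))).
  by move=> x + x0 _; exact.
apply: (aeS _ H) => x {}H x0 m; elim=> [|N IHN].
  rewrite big_nil (_ : partial_flow m 0 = fun=> v 0 ^+ m).
    exact: cis_derive_cst.
  by apply/funext => y; exact: partial_flow0.
have -> : \sum_(i <- iota 1 N.+1) m%:R * (a i x * partial_flow (m + i) (N.+1 - i) x) =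
    \sum_(i <- iota 1 N) m%:R * (a i x * partial_flow (m + i) (N - i) x) +
    \sum_(i <- iota 1 N.+1)
      v 0 ^+ (m + N.+1) * (m%:R * (a i x * flow_coef a (N.+1 - i) (m + i) x)).
  rewrite !big_iota1S subnn partial_flow0 flow_coef0 addrA; congr (_ + _); last by ring.
  rewrite -big_split [LHS]big_seq [RHS]big_seq; apply: eq_bigr => i.
  rewrite mem_iota => /andP[i1 iN].
  rewrite subSn; last by lia.
  rewrite partial_flowS /= (_ : (m + i + (N - i).+1 = m + N.+1)%N); last by lia.
  by ring.
rewrite (_ : partial_flow m N.+1 = fun y => partial_flow m N y +
  \sum_(i <- iota 1 N.+1) v 0 ^+ (m + N.+1) * (m%:R *
    cintegral0 (fun s => a i s * flow_coef a (N.+1 - i) (m + i) s) y)); last first.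
  by apply/funext => y; rewrite partial_flowS flow_coefS//; congr (_ + _);
    rewrite mulrC mulr_sumr.
apply: cis_deriveD; first exact: IHN.
apply: cis_derive_sum => i; rewrite mem_iota => /andP[i0 _].
have dz (c z : C) f : cis_derive f x z -> cis_derive (fun y => c * f y) x (c * z).
  move=> df; have := cis_deriveM (cis_derive_cst c x) df.
  by rewrite mulr0 addr0.
by apply: (dz); apply: (dz); exact: H.
Qed.

(** The derivative of the error is m times the sum of v^(m-1) times a tail of the series and of the
    products of a_i with the errors for (m + i, N - i). The latter are bounded by induction with the
    same exponential, and the powers of 4 make their sum a convergent geometric one. *)
Lemma flow_error m N x : (0 < m)%N -> 0 <= x <= T ->
  N1 (v x ^+ m - partial_flow m N x) <=
  rho ^+ m * (4 * (l * rho)) ^+ N.+1 * expR (2 * (m + N)%:R * x).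
Proof.
move: N m x; elim/ltn_ind => N IHN m X m0 /andP[X0 XT].
have lr0 : 0 <= l * rho by rewrite mulr_ge0// ltW.
pose K := rho ^+ m * (4 * (l * rho)) ^+ N.+1.
have K0 : 0 <= K by rewrite /K mulr_ge0// exprn_ge0 ?(ltW rho0)// mulr_ge0.
pose c : R := 2 * (m + N)%:R; rewrite -/K -/c.
have c0 : 0 <= c by rewrite mulr_ge0.
(* Half of the desired bound, since [clipschitz_mean_value] doubles the majorant. *)
pose phi x : R := K / 2 * expR (c * x).
have -> : K * expR (c * X) = 2 * phi X by rewrite /phi; lra.
have phi0 : 0 <= phi 0 by rewrite /phi mulr_ge0 ?expR_ge0// divr_ge0.
have E0 : v 0 ^+ m - partial_flow m N 0 = 0 by rewrite partial_flow_at0 subrr.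
rewrite -[_ - _]subr0 -E0.
suff : N1 (v X ^+ m - partial_flow m N X - (v 0 ^+ m - partial_flow m N 0)) <=
    2 * (phi X - phi 0) by lra.
have [k mk] : exists k, m = k.+1.
  by case: m m0 {K K0 c c0 phi phi0 E0} => // k _; exists k.
have [L LE] : lipschitz1 T (fun x => v x ^+ m - partial_flow m N x).
  apply: lipschitz1B; last exact: lipschitz1_partial_flow.
  by rewrite mk; apply: lipschitz1X vrho solution_lipschitz.
pose dphi x : R := K / 2 * (c * expR (c * x)).
apply: (@clipschitz_mean_value R (fun x => v x ^+ m - partial_flow m N x) phi
  dphi L (K / 2 * (c * expR (c * X))) X) => //.
- move=> x y /andP[x0 xX] /andP[y0 yX].
  by apply: LE; rewrite ?x0 ?y0 (le_trans _ XT).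
- have expL x y : x <= y -> y <= X ->
      expR (c * y) - expR (c * x) <= c * expR (c * X) * (y - x).
    move=> xy yX; have E : c * x = c * y + - (c * (y - x)) by ring.
    rewrite E expRD -[X in X - _]mulr1 -mulrBr.
    rewrite (@le_trans _ _ (expR (c * y) * (c * (y - x))))//.
      rewrite ler_wpM2l ?expR_ge0//.
      by have := expR_ge1Dx (- (c * (y - x))); lra.
    rewrite [leRHS]mulrAC [leRHS]mulrC ler_wpM2r ?ler_expR ?ler_wpM2l//.
    by rewrite mulr_ge0// subr_ge0.
  have H x y : x <= y -> y <= X ->
      `|phi x - phi y| <= K / 2 * (c * expR (c * X)) * `|x - y|.
    move=> xy yX; rewrite distrC [`|x - y|]distrC [`|y - x|]ger0_norm ?subr_ge0//.
    rewrite /phi -mulrBr normrM (ger0_norm (_ : 0 <= K / 2)) ?divr_ge0//.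
    rewrite -[leRHS]mulrA ler_wpM2l ?divr_ge0// ger0_norm ?expL//.
    by rewrite subr_ge0 ler_expR ler_wpM2l.
  move=> x y /andP[x0 xX] /andP[y0 yX].
  have [/H|/ltW /H] := leP x y; first exact.
  by move=> /(_ xX); rewrite distrC (distrC y).
- move=> x _; rewrite /phi /dphi.
  have d1 : is_derive x 1 (fun y : R => c * y) c.
    by apply: is_derive_eq; rewrite /GRing.scale/= mulr1.
  have d2 := is_derive1_comp (is_derive_expR (c * x)) d1.
  have d3 : is_derive x 1 (fun y : R => K / 2 * expR (c * y))
      (K / 2 *: (expR (c * x) * c)) by exact: is_deriveZ d2.
  apply: is_derive_eq d3 _.
  by rewrite -[LHS]/(K / 2 * (expR (c * x) * c)); ring.
have [_ dv] := sol.
apply: (aeS _ (ae_and dv partial_flow_derive)) => x [dvx dpf] /andP[x0 xX].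
have xT : x <= T by rewrite (le_trans (ltW xX)).
have [|z sz dz] := dvx.
  by rewrite in_itv/= (ltW x0).
exists (k.+1%:R * v x ^+ k * z -
    \sum_(i <- iota 1 N) m%:R * (a i x * partial_flow (m + i) (N - i) x)).
  have vx : N1 (v x) <= rho by rewrite vrho// (ltW x0).
  have tail := cseries_tail N vx lrho sz.
  pose e := expR (c * x).
  have e1 : 1 <= e by rewrite -expR0 ler_expR mulr_ge0// ltW.
  have -> : k.+1%:R * v x ^+ k * z -
      \sum_(i <- iota 1 N) m%:R * (a i x * partial_flow (m + i) (N - i) x) =
      m%:R * (v x ^+ k * (z - \sum_(i <- iota 1 N) a i x * v x ^+ i.+1) +
        \sum_(i <- iota 1 N)
          a i x * (v x ^+ (m + i) - partial_flow (m + i) (N - i) x)).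
    rewrite -mulr_sumr -mulrA -mk -mulrBr; congr (_ * _).
    rewrite mulrBr -addrA; congr (_ + _).
    rewrite -sumrN mulr_sumr -sumrN -big_split/=.
    apply: eq_bigr => i _; rewrite mk addSnnS exprD; ring.
  have B1 : N1 (v x ^+ k * (z - \sum_(i <- iota 1 N) a i x * v x ^+ i.+1)) <= K / 2.
    rewrite (le_trans (norm1M _ _))//.
    rewrite (@le_trans _ _ (rho ^+ k * (2 * rho * (l * rho) ^+ N.+1)))//.
      rewrite ler_pM ?norm1_ge0// (le_trans (norm1X _ _))//.
      by rewrite lerXn2r ?nnegrE ?norm1_ge0// ltW.
    rewrite /K mk [(4 * (l * rho)) ^+ _]exprMn [4 ^+ _]exprS.
    have H4 : 1 <= 4 ^+ N :> R by rewrite exprn_ege1// ler1n.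
    have P0 : 0 <= rho ^+ k.+1 * (l * rho) ^+ N.+1.
      by rewrite mulr_ge0// exprn_ge0// ltW.
    have := ler_wpM2l P0 H4; rewrite [rho ^+ k.+1]exprSr.
    set p := rho ^+ k; set q := (l * rho) ^+ N.+1; set t := 4 ^+ N; lra.
  (* The bound for (m + i, N - i), multiplied by l^i, equals K e 4^(-i); summing over i >= 1 gives
     at most K e / 3. *)
  have geo : \sum_(i <- iota 1 N) (4^-1 : R) ^+ i <= 3^-1.
    suff -> : \sum_(i <- iota 1 N) (4^-1 : R) ^+ i = 3^-1 * (1 - 4^-1 ^+ N).
      by rewrite ler_piMr// gerBl exprn_ge0.
    elim: (N) => [|n IHn]; first by rewrite big_nil expr0 subrr mulr0.
    by rewrite big_iota1S IHn exprS; lra.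
  have B2 : N1 (\sum_(i <- iota 1 N)
      a i x * (v x ^+ (m + i) - partial_flow (m + i) (N - i) x)) <= K * e * 3^-1.
    rewrite (le_trans (norm1_sum _ _ _))//.
    rewrite (@le_trans _ _ (\sum_(i <- iota 1 N) K * e * 4^-1 ^+ i))//; last first.
      by rewrite -mulr_sumr ler_wpM2l// mulr_ge0// expR_ge0.
    rewrite [leLHS]big_seq [leRHS]big_seq; apply: ler_sum => i.
    rewrite mem_iota add1n ltnS => /andP[i0 iN].
    rewrite (le_trans (norm1M _ _))//.
    have IH : N1 (v x ^+ (m + i) - partial_flow (m + i) (N - i) x) <=
        rho ^+ (m + i) * (4 * (l * rho)) ^+ (N - i).+1 * e.
      have iN' : (N - i < N)%N by rewrite ltn_subrL i0 (leq_trans i0).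
      have mi : (0 < m + i)%N by rewrite addn_gt0 m0.
      have x0T : 0 <= x <= T by rewrite (ltW x0).
      have := IHN _ iN' _ _ mi x0T.
      by rewrite -addnA subnKC.
    rewrite (le_trans (ler_pM (norm1_ge0 _) (norm1_ge0 _) (al x i0) IH))//.
    rewrite le_eqVlt; apply/orP; left; apply/eqP.
    have -> : K = rho ^+ m * ((4 * (l * rho)) ^+ i * (4 * (l * rho)) ^+ (N - i).+1).
      by rewrite /K -exprD; rewrite addnS subnKC.
    rewrite [(4 * (l * rho)) ^+ i]exprMn [(l * rho) ^+ i]exprMn exprD.
    set p := (4 * (l * rho)) ^+ (N - i).+1.
    have H4 : 4 ^+ i * (4^-1) ^+ i = 1 :> R by rewrite -exprMn divff// expr1n.
    transitivity (l ^+ i * (rho ^+ m * rho ^+ i * p * e) * (4 ^+ i * 4^-1 ^+ i)).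
      by rewrite H4 mulr1.
    by ring.
  (* The two parts contribute at most K / 2 and K e / 3, together at most K e because e >= 1. The
     rate c was chosen so that [dphi x] is (m + N) K e, which dominates m K e. *)
  rewrite (le_trans (norm1M _ _))// norm1_natr /dphi -/e.
  rewrite (@le_trans _ _ (m%:R * (K / 2 + K * e * 3^-1)))//.
    by rewrite ler_wpM2l// (le_trans (norm1D _ _))// lerD.
  have KKe : K <= K * e by rewrite ler_peMr.
  have Ke0 : 0 <= K * e by rewrite mulr_ge0// expR_ge0.
  rewrite (@le_trans _ _ (m%:R * (K * e)))//; first by rewrite ler_wpM2l//; lra.
  have -> : K / 2 * (c * e) = (m + N)%:R * (K * e) by rewrite /c; field.
  by rewrite ler_wpM2r// ler_nat leq_addr.
apply: cis_deriveB; last exact: dpf.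
by rewrite mk; exact: cis_deriveX.
Qed.

End Solution.
End Estimates.

(** * Existence of solutions *)

Section GeometricLimits.
Variable R : realType.
Notation C := R[i].
Notation N1 := (@norm1 R).
Notation h := (2^-1 : R).

Lemma cvg_halfX (B : R) : B * h ^+ k @[k --> \oo] --> 0.
Proof.
rewrite -[X in _ --> X](mulr0 B); apply: cvgMr; apply: cvg_expr.
by rewrite gtr0_norm ?invf_lt1// ltr1n.
Qed.

Lemma le_halfX (x y B : R) : (forall k, x <= y + B * h ^+ k) -> x <= y.
Proof.
move=> H; apply/ler_addgt0Pr => e e0.
have /cvgrPdist_le/(_ e e0)[k _ /(_ k (leqnn k))] := cvg_halfX B.
rewrite sub0r normrN => Bk; rewrite (le_trans (H k))// lerD2l.
exact: le_trans (ler_norm _) Bk.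
Qed.

Lemma real_geometric_limit (u : nat -> R) (B : R) :
  (forall k, `|u k.+1 - u k| <= B * h ^+ k) ->
  exists z, forall k, `|z - u k| <= 2 * B * h ^+ k.
Proof.
(* [s] is nondecreasing, [t] is nonincreasing, and [u] lies in between. *)
move=> du; pose s k := u k - 2 * B * h ^+ k; pose t k := u k + 2 * B * h ^+ k.
have B0 k : 0 <= B * h ^+ k by rewrite (le_trans _ (du k)).
have sS : {homo s : i j / (i <= j)%N >-> i <= j}.
  apply: homo_leq => // [x y z|k]; first exact: le_trans.
  by rewrite /s exprS; have := du k; rewrite ler_norml; have := B0 k; lra.
have tS : {homo t : i j / (i <= j)%N >-> i >= j}.
  apply: homo_leq => // [x y z|k]; first by move=> xy /le_trans; apply.
  by rewrite /t exprS; have := du k; rewrite ler_norml; have := B0 k; lra.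
have st i j : s i <= t j.
  rewrite (le_trans (sS _ _ (leq_maxl i j)))//.
  rewrite (le_trans _ (tS _ _ (leq_maxr i j)))//.
  by rewrite /s /t; have := B0 (maxn i j); lra.
have hs : has_sup (range s).
  split; first by exists (s 0%N); exists 0%N.
  by exists (t 0%N) => _ [k _ <-].
exists (sup (range s)) => k; rewrite ler_norml.
have s1 : s k <= sup (range s).
  by apply: sup_upper_bound => //; exists k.
have s2 : sup (range s) <= t k.
  by apply: ge_sup => [|_ [j _ <-]//]; exact: hs.1.
by move: s1 s2; rewrite /s /t; lra.
Qed.

Lemma geometric_limit (u : nat -> C) (B : R) :
  (forall k, N1 (u k.+1 - u k) <= B * h ^+ k) ->
  exists z, forall k, N1 (z - u k) <= 4 * B * h ^+ k.
Proof.
move=> du.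
have [x Hx] : exists x, forall k, `|x - complex.Re (u k)| <= 2 * B * h ^+ k.
  apply: real_geometric_limit => k; rewrite -complex_ReB (le_trans _ (du k))//.
  by rewrite /norm1 lerDl.
have [y Hy] : exists y, forall k, `|y - complex.Im (u k)| <= 2 * B * h ^+ k.
  apply: real_geometric_limit => k; rewrite -complex_ImB (le_trans _ (du k))//.
  by rewrite /norm1 lerDr.
exists (x +i* y) => k; rewrite /norm1 complex_ReB complex_ImB /=.
by have := Hx k; have := Hy k; lra.
Qed.

Lemma cmlbounded_geometric_limit (f : nat -> R -> C) (g : R -> C) (B K : R) :
  (forall k, cmlbounded (f k)) -> (forall x, N1 (g x) <= K) ->
  (forall k x, N1 (g x - f k x) <= B * h ^+ k) -> cmlbounded g.
Proof.
move=> mf gK gf; apply: cmlbounded_norm1; last by exists K.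
  apply: (@measurable_fun_cvg _ _ _ _ (fun k x => complex.Re (f k x))).
    by move=> k; exact: (mf k).1.1.
  move=> x _; apply/cvgrPdist_le => e e0.
  have /cvgrPdist_le/(_ e e0) := cvg_halfX B.
  apply: filterS => k; rewrite sub0r normrN => H.
  rewrite -complex_ReB (le_trans _ (le_trans (gf k x) (le_trans (ler_norm _) H)))//.
  by rewrite /norm1 lerDl.
apply: (@measurable_fun_cvg _ _ _ _ (fun k x => complex.Im (f k x))).
  by move=> k; exact: (mf k).2.1.
move=> x _; apply/cvgrPdist_le => e e0.
have /cvgrPdist_le/(_ e e0) := cvg_halfX B.
apply: filterS => k; rewrite sub0r normrN => H.
rewrite -complex_ImB (le_trans _ (le_trans (gf k x) (le_trans (ler_norm _) H)))//.
by rewrite /norm1 lerDr.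
Qed.

End GeometricLimits.

Section Clamp.
Variables (R : realType) (T : R).
Hypothesis T0 : 0 <= T.

Definition clamp x : R := Num.max 0 (Num.min x T).

Lemma clampI x : 0 <= clamp x <= T.
Proof. by rewrite le_max lexx ge_max T0 ge_min lexx orbT. Qed.

Lemma clamp_id x : 0 <= x <= T -> clamp x = x.
Proof. by move=> /andP[x0 xT]; rewrite /clamp min_l// max_r. Qed.

Lemma mlbounded_clamp (f : R -> R) : mlbounded f -> mlbounded (f \o clamp).
Proof.
move=> [mf bf]; split; last first.
  move=> M; have [K fK] := bf T; exists K => x _ /=; apply: fK.
  by have /andP[c0 cT] := clampI x; rewrite ger0_norm.
apply: (measurableT_comp mf); apply: measurable_maxr; first exact: measurable_cst.
by apply: measurable_minr; [exact: measurable_id|exact: measurable_cst].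
Qed.

Lemma cmlbounded_clamp (f : R -> R[i]) : cmlbounded f -> cmlbounded (f \o clamp).
Proof.
by move=> [f1 f2]; split; [exact: (mlbounded_clamp f1)|exact: (mlbounded_clamp f2)].
Qed.

End Clamp.

Section Existence.
Variable R : realType.
Notation C := R[i].
Notation mu := (@lebesgue_measure R).
Notation N1 := (@norm1 R).
Notation T := (pi *+ 2 : R).
Notation h := (2^-1 : R).
Variables (a : nat -> R -> C) (l : R).
Hypothesis l0 : 0 < l.
Hypothesis abnd : forall i, (0 < i)%N -> cmlbounded (a i).
Hypothesis al : forall i x, (0 < i)%N -> N1 (a i x) <= l ^+ i.
Variables (rho : R) (w0 : C).
Hypothesis rho0 : 0 < rho.
Hypothesis w0_le : N1 w0 <= rho / 2.
Hypothesis lrho : 4 * (l * rho) <= 1.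
Hypothesis lrhoT : 20 * (l * rho) * T <= 1.

Definition truncation n x w : C := \sum_(i <- iota 1 n) a i x * w ^+ i.+1.

(* The k-th step only uses the first k terms of the series, so that all the
   integrands are finite sums; clamping the time makes the bounds hold on the
   whole line. *)
Fixpoint picard k : R -> C := if k is k'.+1 then
  fun x => w0 + cintegral0 (fun s => truncation k' s (picard k' s)) (clamp T x)
  else fun=> w0.

Lemma geometric_sum_le (q : R) n : 0 <= q -> 2 * q <= 1 ->
  \sum_(i <- iota 1 n) q ^+ i <= 2 * q.
Proof.
move=> q0 q1; suff : \sum_(i <- iota 1 n) q ^+ i <= 2 * q - 2 * q ^+ n.+1.
  by move/le_trans; apply; rewrite gerBl mulr_ge0// exprn_ge0.
elim: n => [|n IHn]; first by rewrite big_nil expr1 subrr.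
rewrite big_iota1S (le_trans (lerD IHn (lexx _)))//.
have := exprn_ge0 n.+1 q0; rewrite [q ^+ n.+2]exprS; set p := q ^+ n.+1 => p0.
suff : 2 * q * p <= 1 * p by lra.
by rewrite ler_wpM2r.
Qed.

Lemma truncation_le n x w : N1 w <= rho -> N1 (truncation n x w) <= 2 * rho * (l * rho).
Proof.
move=> wr; have q0 : 0 <= l * rho by rewrite mulr_ge0// ltW.
rewrite (le_trans (norm1_sum _ _ _))//.
rewrite (@le_trans _ _ (\sum_(i <- iota 1 n) rho * (l * rho) ^+ i))//; last first.
  rewrite -mulr_sumr -[leRHS]mulrA mulrCA; apply: ler_wpM2l; first exact: ltW.
  by apply: geometric_sum_le => //; have := lrho; lra.
rewrite [leLHS]big_seq [leRHS]big_seq; apply: ler_sum => i.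
rewrite mem_iota => /andP[i0 _].
rewrite (le_trans (norm1M _ _))// exprMn mulrCA -exprS.
rewrite ler_pM ?norm1_ge0 ?al// (le_trans (norm1X _ _))//.
by rewrite lerXn2r ?nnegrE ?norm1_ge0// ltW.
Qed.

(** The Lipschitz constant of w^(i+1) carries a factor i + 1 <= 2^i, so the geometric ratio becomes
    2 (l rho), at most 1 / 2 by [lrho]. *)
Lemma truncation_diff n x w w' : N1 w <= rho -> N1 w' <= rho ->
  N1 (truncation n x w - truncation n x w') <= 4 * (l * rho) * N1 (w - w').
Proof.
move=> wr w'r; have q0 : 0 <= l * rho by rewrite mulr_ge0// ltW.
rewrite /truncation -sumrB (le_trans (norm1_sum _ _ _))//.
rewrite (@le_trans _ _
  (\sum_(i <- iota 1 n) (2 * (l * rho)) ^+ i * N1 (w - w')))//; last first.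
  rewrite -mulr_suml ler_wpM2r ?norm1_ge0// (_ : 4 * _ = 2 * (2 * (l * rho))); last by ring.
  by apply: geometric_sum_le; have := lrho; lra.
rewrite [leLHS]big_seq [leRHS]big_seq; apply: ler_sum => i.
rewrite mem_iota => /andP[i0 _].
rewrite -mulrBr (le_trans (norm1M _ _))//.
rewrite (le_trans (ler_pM (norm1_ge0 _) (norm1_ge0 _) (al x i0) (norm1_subX i wr w'r)))//.
rewrite [leLHS]mulrA ler_wpM2r ?norm1_ge0// mulrCA.
rewrite [(2 * _) ^+ i]exprMn [(l * rho) ^+ i]exprMn.
rewrite ler_wpM2r ?mulr_ge0 ?exprn_ge0 ?(ltW l0) ?(ltW rho0)//.
rewrite -natrX ler_nat; exact: ltn_expl.
Qed.

Lemma cmlbounded_truncation n f : cmlbounded f ->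
  cmlbounded (fun s => truncation n s (f s)).
Proof.
move=> mf; apply: cmlbounded_sum => i; rewrite mem_iota => /andP[i0 _].
by apply: cmlboundedM; [exact: abnd|exact: cmlboundedX].
Qed.

Let T0 : 0 <= T. Proof. exact/ltW/period_gt0. Qed.

Lemma cmlbounded_picard k : cmlbounded (picard k).
Proof.
elim: k => [|k IHk]; first exact: cmlbounded_cst.
apply: cmlboundedD; first exact: cmlbounded_cst.
exact/(cmlbounded_clamp T0)/cmlbounded_cintegral0/cmlbounded_truncation.
Qed.

Lemma cintegral0_clamp_le (f : R -> C) (K : R) x : cmlbounded f ->
  (forall x, N1 (f x) <= K) -> N1 (cintegral0 f (clamp T x)) <= 2 * K * T.
Proof.
move=> mf fK; have /andP[c0 cT] := clampI T0 x.
have K0 : 0 <= K by exact: le_trans (norm1_ge0 _) (fK 0).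
have := cintegral0_lipschitz_itv mf c0 (fun x _ => fK x).
rewrite cintegral00 !subr0 => /le_trans; apply.
by rewrite ler_wpM2l// mulr_ge0.
Qed.

Lemma picard_le k x : N1 (picard k x) <= rho.
Proof.
elim: k x => [|k IHk] x /=; first by have := w0_le; have := rho0; lra.
rewrite (le_trans (norm1D _ _))//.
have := @cintegral0_clamp_le _ (2 * rho * (l * rho)) x
  (cmlbounded_truncation k (cmlbounded_picard k)) (fun s => truncation_le k s (IHk s)).
have -> : 2 * (2 * rho * (l * rho)) * T = rho * (4 * (l * rho) * T) by ring.
have : rho * (4 * (l * rho) * T) <= rho * 2^-1.
  rewrite ler_pM2l//; have : 0 <= (l * rho) * T by rewrite !mulr_ge0// ltW.
  by have := lrhoT; rewrite -!mulrA; lra.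
by have := w0_le; lra.
Qed.

(** The 5 is 4 for the Lipschitz constant of the truncation plus 1 for the term of index k + 1,
    present only in the longer sum. *)
Lemma truncation_picard_diff k s :
  N1 (picard k.+1 s - picard k s) <= rho * h ^+ k ->
  N1 (truncation k.+1 s (picard k.+1 s) - truncation k s (picard k s)) <=
  5 * (l * rho) * rho * h ^+ k.
Proof.
move=> D; have q0 : 0 <= l * rho by rewrite mulr_ge0// ltW.
rewrite {1}/truncation big_iota1S addrAC (le_trans (norm1D _ _))//.
have := truncation_diff k s (picard_le k.+1 s) (picard_le k s); rewrite /truncation.
move=> H; rewrite (le_trans (lerD H (lexx _)))//.
have H2 : N1 (a k.+1 s * picard k.+1 s ^+ k.+2) <= (l * rho) * rho * h ^+ k.
  rewrite (le_trans (norm1M _ _))//.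
  rewrite (@le_trans _ _ (l ^+ k.+1 * rho ^+ k.+2))//.
    rewrite ler_pM ?norm1_ge0 ?al// (le_trans (norm1X _ _))//.
    by rewrite lerXn2r ?nnegrE ?norm1_ge0 ?picard_le// ltW.
  have -> : l ^+ k.+1 * rho ^+ k.+2 = l * rho * rho * (l * rho) ^+ k.
    by rewrite exprMn exprS !exprSr; ring.
  rewrite ler_wpM2l ?mulr_ge0 ?(ltW rho0) ?(ltW l0)// lerXn2r ?nnegrE ?invr_ge0//.
  by have := lrho; lra.
have H1 : 4 * (l * rho) * N1 (picard k.+1 s - picard k s) <=
    4 * (l * rho) * (rho * h ^+ k).
  by rewrite ler_wpM2l// mulr_ge0.
rewrite (le_trans (lerD H1 H2))//; lra.
Qed.

(** Integration over [0, T] multiplies the previous bound by 2 T, so the contraction factor is 10 (l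
    rho) T. It is at most 1 / 2 by [lrhoT], which is where the constant 20 comes from. *)
Lemma picard_diff k x : N1 (picard k.+1 x - picard k x) <= rho * h ^+ k.
Proof.
have h0 : 0 <= h by rewrite invr_ge0.
elim: k x => [|k IHk] x.
  rewrite /=.
  rewrite (_ : (fun s => truncation 0 s w0) = fun=> 0); last first.
    by apply/funext => s; rewrite /truncation big_nil.
  by rewrite cintegral0_cst mul0r addr0 subrr norm10 mulr_ge0 ?(ltW rho0)// exprn_ge0.
have mt n := cmlbounded_truncation n (cmlbounded_picard n).
rewrite -[picard k.+2 x]/(w0 + cintegral0 (fun s =>
  truncation k.+1 s (picard k.+1 s)) (clamp T x)).
rewrite -[X in N1 (_ - X)]/(w0 + cintegral0 (fun s =>
  truncation k s (picard k s)) (clamp T x)).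
set f1 := (fun s => truncation k.+1 s (picard k.+1 s)).
set f0 := (fun s => truncation k s (picard k s)).
have -> : w0 + cintegral0 f1 (clamp T x) - (w0 + cintegral0 f0 (clamp T x)) =
    cintegral0 (fun s => f1 s - f0 s) (clamp T x).
  have {1}-> : f1 = (fun s => (f1 s - f0 s) + f0 s).
    by apply/funext => s; rewrite subrK.
  rewrite cintegral0D; [|exact: (cmlboundedB (mt k.+1) (mt k))|exact: mt].
  by ring.
have := @cintegral0_clamp_le _ (5 * (l * rho) * rho * h ^+ k) x
  (cmlboundedB (mt k.+1) (mt k)) (fun s => truncation_picard_diff (IHk s)).
move/le_trans; apply; rewrite exprS.
have -> : 2 * (5 * (l * rho) * rho * h ^+ k) * T =
  (rho * h ^+ k) * (20 * (l * rho) * T * 2^-1) by field.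
rewrite [rho * (_ * _)]mulrCA [leRHS]mulrC ler_wpM2l//.
  by rewrite mulr_ge0 ?exprn_ge0// ltW.
by have := lrhoT; lra.
Qed.

Lemma solution_exists : exists2 v, is_solution a v & v 0 = w0.
Proof.
have h0 : 0 <= h by rewrite invr_ge0.
have q0 : 0 <= l * rho by rewrite mulr_ge0// ltW.
have hk0 k : 0 <= rho * h ^+ k by rewrite mulr_ge0 ?exprn_ge0// ltW.
pose f k s := truncation k s (picard k s).
have mf k : cmlbounded (f k).
  by apply: cmlbounded_truncation; exact: cmlbounded_picard.
have /choice[v vE] : forall x, exists z, forall k,
    N1 (z - picard k x) <= 4 * rho * h ^+ k.
  by move=> x; apply: geometric_limit => k; exact: picard_diff.
(* The limit [Z] of the truncated right-hand sides turns out to be both the integrand that produces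
   v and the sum of the series at v. The factor 2 rounds up 5 (l rho) <= 5 / 4. *)
have /choice[Z ZE] : forall x, exists z, forall k,
    N1 (z - f k x) <= 4 * (2 * rho) * h ^+ k.
  move=> x; apply: geometric_limit => k.
  rewrite (le_trans (truncation_picard_diff (picard_diff k x)))//.
  rewrite -[leLHS]mulrA -[leRHS]mulrA ler_wpM2r//.
  by have := lrho; lra.
have v_le x : N1 (v x) <= rho.
  apply: (@le_halfX _ _ _ (4 * rho)) => k.
  rewrite -[v x](subrK (picard k x)) (le_trans (norm1D _ _))// addrC.
  by rewrite lerD ?picard_le.
have mZ : cmlbounded Z.
  apply: (@cmlbounded_geometric_limit _ f Z (4 * (2 * rho)) (4 * (2 * rho))) => //.
  by move=> x; have := ZE x 0%N; rewrite expr0 mulr1 /f /truncation big_nil subr0.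
(* Both sides are within a multiple of 2^(-k) of [picard k.+1 x], for every k. *)
have vZ x : v x = w0 + cintegral0 Z (clamp T x).
  apply/eqP; rewrite -subr_eq0; apply/eqP/norm1_eq0/eqP.
  rewrite eq_le norm1_ge0 andbT.
  apply: (@le_halfX _ _ _ (4 * rho + 2 * (4 * (2 * rho)) * T)) => k.
  have -> : v x - (w0 + cintegral0 Z (clamp T x)) =
      (v x - picard k.+1 x) - cintegral0 (fun s => Z s - f k s) (clamp T x).
    have {1}-> : Z = (fun s => (Z s - f k s) + f k s).
      by apply/funext => s; rewrite subrK.
    rewrite cintegral0D; [|exact: cmlboundedB|exact: mf].
    by rewrite /= -/(f k); ring.
  rewrite add0r (le_trans (norm1B _ _))// mulrDl lerD//.
    rewrite (le_trans (vE x k.+1))// exprS -mulrA [leRHS]mulrC mulrC.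
    have := hk0 k; lra.
  have := @cintegral0_clamp_le _ (4 * (2 * rho) * h ^+ k) x
    (cmlboundedB mZ (mf k)) (fun s => ZE s k).
  by move/le_trans; apply; lra.
exists v; last first.
  by rewrite vZ clamp_id ?lexx//= cintegral00 addr0.
split.
  have [K ZK] := cintegral0_lipschitz T mZ; exists K => x y.
  rewrite /= !in_itv/= => xT yT; rewrite (le_trans (normc_le_norm1 _))//.
  rewrite !vZ !clamp_id// opprD addrACA subrr add0r ZK//.
    by case/andP: xT => x0 ?; rewrite ger0_norm.
  by case/andP: yT => y0 ?; rewrite ger0_norm.
(* The endpoints are discarded because [clamp] has kinks there. *)
have nz : {ae mu, forall x : R, x != 0 /\ x != T}.
  exists [set 0; T]; split; first exact: measurableU.
    by apply/countable_lebesgue_measure0/finite_set_countable.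
  move=> x /= /not_andP[|] /negP; rewrite negbK => /eqP ->; [by left|by right].
apply: (aeS _ (ae_and nz (cintegral0_derive mZ))) => x [[xn0 xnT] dZ].
rewrite in_itv/= => /andP[x0 xT].
have {}x0 : 0 < x by rewrite lt_neqAle eq_sym xn0.
have {}xT : x < T by rewrite lt_neqAle xnT.
exists (Z x).
  rewrite /cseries_from1; apply/cvgrPdist_le => e e0.
  (* The 12 is 4 for replacing v by the n-th iterate inside the truncation, plus 8 for the distance
     from that truncation to [Z x]. *)
  have /cvgrPdist_le/(_ e e0) := cvg_halfX (12 * rho).
  apply: filterS => n; rewrite !sub0r !normrN => H.
  rewrite big_iotaE ger0_norm; last by case: (_ - _) => ? ? /=; exact: sqrtr_ge0.
  rewrite (le_trans (normc_le_norm1 _))// (le_trans _ (le_trans (ler_norm _) H))//.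
  rewrite -[X in N1 (X - _)]/(truncation n x (v x)).
  rewrite -(subrKA (f n x)) (le_trans (norm1D _ _))//.
  have := truncation_diff n x (v_le x) (picard_le n x); rewrite -/(f n x) => H1.
  have H2 := ZE x n; rewrite dist1C in H2.
  rewrite (le_trans (lerD H1 H2))//.
  have H3 : 4 * (l * rho) * N1 (v x - picard n x) <= 1 * (4 * rho * h ^+ n).
    by apply: ler_pM => //; [rewrite mulr_ge0|exact: norm1_ge0].
  by have := H3; lra.
have nearE : \near x, w0 + cintegral0 Z x = v x.
  near=> y; rewrite vZ clamp_id//; apply/andP; split; apply: ltW; near: y.
    exact: lt_nbhsr.
  exact: lt_nbhsl.
have [d1 d2] := cis_deriveD (cis_derive_cst w0 x) (dZ x0); rewrite add0r in d1 d2.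
split; [apply: near_eq_is_derive d1|apply: near_eq_is_derive d2];
  by apply: filterS nearE => y ->.
Unshelve. all: by end_near. Qed.

End Existence.

(** * The equivalence *)

Section BoundedCoefficients.
Variable R : realType.
Notation C := R[i].
Notation mu := (@lebesgue_measure R).
Notation N1 := (@norm1 R).
Notation T := (pi *+ 2 : R).
Variables (a : nat -> R -> C) (l : R).
Hypothesis l0 : 0 < l.
Hypothesis abnd : forall i, (0 < i)%N -> cmlbounded (a i).
Hypothesis al : forall i x, (0 < i)%N -> N1 (a i x) <= l ^+ i.
Hypothesis aT : forall i, (0 < i)%N -> periodic (a i) T.

Let T0 : 0 < T. Proof. exact: period_gt0. Qed.

Lemma flow_coef_center :
  (forall n m, (0 < n)%N -> (0 < m)%N -> flow_coef a n m T = 0) ->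
  determines_center a.
Proof.
(* With l * rho = 1 / M, the one constant M covers all smallness conditions: the convergence of the
   series, the bound on v over a period, and the factor e^(2 T) gained at each order. Only the power
   m = 1 is expanded. *)
move=> G0; pose M := 16 * (1 + T) * expR (2 * T).
have e1 : 1 <= expR (2 * T) by rewrite -expR0 ler_expR mulr_ge0// ltW.
have M0 : 0 < M by rewrite /M !mulr_gt0 ?expR_gt0// addr_gt0.
pose rho := (l * M)^-1; have rho0 : 0 < rho by rewrite invr_gt0 mulr_gt0.
have lrho : l * rho = M^-1 by rewrite /rho invfM mulrA divff ?mul1r ?gt_eqF.
have HM (c : R) : c <= M -> c * (l * rho) <= 1.
  by move=> cM; rewrite lrho ler_pdivrMr// mul1r.
have T1 : 1 <= 1 + T by rewrite lerDl ltW.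
have M16T : 16 * (1 + T) <= M by rewrite /M ler_peMr// mulr_ge0// addr_ge0// ltW.
have M16e : 16 * expR (2 * T) <= M.
  by rewrite /M -mulrA ler_wpM2l// ler_peMl ?expR_ge0.
have H16 : 16 * (l * rho) <= 1 by apply: HM; have := T1; lra.
have H16T : 16 * T * (l * rho) <= 1.
  by apply: HM; rewrite (le_trans _ M16T)// ler_pM2l// lerDr.
have H16e : 16 * expR (2 * T) * (l * rho) <= 1 by exact: HM.
exists (rho / 8) => [|v sol vr]; first by rewrite divr_gt0.
have v0 : N1 (v 0) <= rho / 4.
  by rewrite (le_trans (norm1_le_normc _))//; move: vr; lra.
have lrho2 : l * rho <= 1 / 2 by lra.
have lT : 4 * (l * rho) * T <= 1 / 4 by rewrite mulrAC; move: H16T; lra.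
have vrho := solution_bound l0 al sol rho0 lrho2 v0 lT.
have pf N : partial_flow a v 1 N T = v 0.
  elim: N => [|N IHN]; first by rewrite partial_flow0 expr1.
  by rewrite partial_flowS IHN G0// mul0r addr0.
apply/eqP; rewrite -subr_eq0; apply/eqP/norm1_eq0/eqP.
rewrite eq_le norm1_ge0 andbT; apply: (@le_halfX _ _ _ rho) => N; rewrite add0r.
have TT : 0 <= T <= T by rewrite lexx ltW.
have := flow_error l0 abnd al sol rho0 lrho2 vrho N (ltn0Sn 0) TT.
rewrite pf !expr1 => /le_trans; apply.
have -> : expR (2 * (1 + N)%:R * T) = expR (2 * T) ^+ N.+1.
  by rewrite -expRM_natl add1n; congr expR; ring.
rewrite -mulrA -exprMn ler_pM2l//.
have q0 : 0 <= l * rho by rewrite mulr_ge0 ?ltW.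
have s0 : 0 <= 4 * (l * rho) * expR (2 * T) by rewrite mulr_ge0 ?expR_ge0// mulr_ge0.
have s1 : 4 * (l * rho) * expR (2 * T) <= 2^-1 by rewrite mulrAC; move: H16e; lra.
rewrite exprS (@le_trans _ _ (1 * 2^-1 ^+ N))//; last by rewrite mul1r.
by rewrite ler_pM ?exprn_ge0//; [lra|rewrite lerXn2r// nnegrE invr_ge0].
Qed.

(** For a solution starting at a real e > 0, both v(T)^m and the expansion of order n - 1 equal e^m.
    The term of order n is therefore the remainder up to sign, which is O(e^(m+n+1)). *)
Lemma center_flow_coef : determines_center a ->
  forall n m, (0 < n)%N -> (0 < m)%N -> flow_coef a n m T = 0.
Proof.
move=> [r r0 cen]; elim/ltn_ind => n IHn m n0 m0.
(* The 64 comes from the condition 4 (l (4 e)) T <= 1 / 4 of [solution_bound]; the other smallness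
   conditions on l e are weaker. *)
pose M := 64 * l * (1 + T).
have T1 : 1 <= 1 + T by rewrite lerDl ltW.
have M0 : 0 < M by rewrite !mulr_gt0// addr_gt0.
pose e0 := Num.min (r / 2) M^-1.
have e00 : 0 < e0 by rewrite lt_min divr_gt0// invr_gt0.
(* For rho = 4 e the bound of [flow_error] is K e times e^(m+n). *)
pose K := 4 ^+ m * (16 * l) ^+ n.+1 * expR (2 * (m + n)%:R * T).
have K0 : 0 <= K by rewrite !mulr_ge0 ?expR_ge0 ?exprn_ge0 ?mulr_ge0// ltW.
have main (e : R) : 0 < e -> e <= e0 -> N1 (flow_coef a n m T) <= K * e.
  move=> ep; rewrite le_min => /andP[er eM].
  have leM : 64 * (l * e) * (1 + T) <= 1.
    have := eM; rewrite -(ler_pM2l M0) divff ?gt_eqF// /M => H.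
    by rewrite (_ : 64 * (l * e) * (1 + T) = 64 * l * (1 + T) * e)//; ring.
  have le0 : 0 < l * e by rewrite mulr_gt0.
  have le1 : 64 * (l * e) <= 1 by rewrite (le_trans _ leM)// ler_peMr// mulr_ge0// ltW.
  have leT : 64 * (l * e) * T <= 1.
    by rewrite (le_trans _ leM)// ler_pM2l ?mulr_gt0// lerDr.
  have Ne : N1 e%:C = e by rewrite norm1_real gtr0_norm.
  (* Existence uses radius 2 e, as the initial value may be half the radius; the estimates below use
     4 e, as [solution_bound] allows only a quarter. *)
  have [||||v sol v0] := @solution_exists R a l l0 abnd al (2 * e) e%:C.
  - by rewrite mulr_gt0.
  - by rewrite Ne; lra.
  - by lra.
  - by lra.
  have rho0 : 0 < 4 * e by rewrite mulr_gt0.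
  have lrho : l * (4 * e) <= 1 / 2 by lra.
  have lT : 4 * (l * (4 * e)) * T <= 1 / 4 by lra.
  have v04 : N1 (v 0) <= 4 * e / 4 by rewrite v0 Ne; lra.
  have vrho := solution_bound l0 al sol rho0 lrho v04 lT.
  have TT : 0 <= T <= T by rewrite lexx ltW.
  have := flow_error l0 abnd al sol rho0 lrho vrho n m0 TT.
  have -> : v T = v 0.
    apply: cen => //; rewrite v0 (le_lt_trans (normc_le_norm1 _))// Ne; lra.
  have pf N : (N < n)%N -> partial_flow a v m N T = v 0 ^+ m.
    elim: N => [_|N IHN Nn]; first by rewrite partial_flow0.
    by rewrite partial_flowS IHN ?(ltnW Nn)// IHn// mul0r addr0.
  have -> : partial_flow a v m n T = v 0 ^+ m + flow_coef a n m T * v 0 ^+ (m + n).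
    by case: n n0 pf {IHn K K0} => // n _ pf; rewrite partial_flowS pf.
  rewrite opprD addNKr norm1N v0 -rmorphXn /=.
  have -> : N1 (flow_coef a n m T * (e ^+ (m + n))%:C) = N1 (flow_coef a n m T) * e ^+ (m + n).
    rewrite /norm1 complex_ReM complex_ImM /= !mulr0 subr0 add0r !normrM.
    by rewrite (ger0_norm (exprn_ge0 _ (ltW ep))) mulrDl.
  have -> : (4 * e) ^+ m * (4 * (l * (4 * e))) ^+ n.+1 * expR (2 * (m + n)%:R * T) =
      K * e * e ^+ (m + n).
    rewrite /K (_ : 4 * (l * (4 * e)) = 16 * l * e); last by ring.
    rewrite !exprMn exprD [e ^+ n.+1]exprS; ring.
  by rewrite ler_pM2r ?exprn_gt0.
apply/norm1_eq0/eqP; rewrite eq_le norm1_ge0 andbT.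
apply/ler_addgt0Pr => e ep; rewrite add0r.
pose e1 := Num.min e0 (e / (K + 1)).
have K1 : 0 < K + 1 by rewrite ltr_wpDl.
have e1p : 0 < e1 by rewrite lt_min e00 divr_gt0.
have e1e0 : e1 <= e0 by rewrite ge_min lexx.
rewrite (le_trans (main _ e1p e1e0))//.
have : (K + 1) * e1 <= e by rewrite mulrC -ler_pdivlMr// ge_min lexx orbT.
by apply: le_trans; rewrite ler_wpM2r ?lerDl// ltW.
Qed.

Lemma bounded_center_monodromy : determines_center a <-> trivial_monodromy a.
Proof.
split=> [cen|/trivial_monodromyE triv].
  apply/trivial_monodromyE => k n m n0 m0.
  exact: (flow_coef_multiples abnd aT (center_flow_coef cen)).
apply: flow_coef_center => n m n0 m0.
by have := triv 1 n m n0 m0; rewrite mul1r.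
Qed.

End BoundedCoefficients.

(** * From essentially bounded to bounded coefficients *)

Section Reduction.
Variable R : realType.
Notation C := R[i].
Notation mu := (@lebesgue_measure R).
Implicit Types a b : nat -> R -> C.

Lemma ae_eq_is_solution a b v :
  {ae mu, forall x, forall i, (0 < i)%N -> a i x = b i x} ->
  is_solution a v -> is_solution b v.
Proof.
move=> ab [Lv dv]; split => //; apply: (aeS _ (ae_and ab dv)) => x [{}ab {}dv] xT.
have [z sz dz] := dv xT; exists z => //.
apply: cvg_trans sz; apply: near_eq_cvg; apply: nearW => n.
congr (Normc.normc (_ - z)); rewrite [LHS]big_nat [RHS]big_nat.
by apply: eq_bigr => i /andP[i0 _]; rewrite ab.
Qed.

Lemma ae_eq_oint (f g : R -> R) x : measurable_fun [set: R] f ->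
  measurable_fun [set: R] g -> {ae mu, forall t, f t = g t} ->
  oint f x = oint g x.
Proof.
move=> mf mg fg; have H (D : set R) : measurable D ->
    \int[mu]_(t in D) f t = \int[mu]_(t in D) g t.
  move=> mD; congr fine; apply: ae_eq_integral => //.
  - by apply/measurable_EFinP; exact: measurable_funTS.
  - by apply/measurable_EFinP; exact: measurable_funTS.
  - by apply: (aeS _ fg) => t /= -> _.
by rewrite /oint !H.
Qed.

Lemma ae_eq_iter_integral a b w : 0%N \notin w ->
  (forall i, (0 < i)%N -> measurable_fun [set: R] (fun x => complex.Re (a i x)) /\
     measurable_fun [set: R] (fun x => complex.Im (a i x))) ->
  (forall i, (0 < i)%N -> cmlbounded (b i)) ->
  {ae mu, forall x, forall i, (0 < i)%N -> a i x = b i x} ->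
  iter_integral a w = iter_integral b w.
Proof.
move=> + ma mb ab; elim: w => // i w IHw.
rewrite inE negb_or eq_sym -lt0n => /andP[i0 w0] /=.
have [[mbr _] [mbi _]] := mb _ i0; have [mar mai] := ma _ i0.
have [[mwr _] [mwi _]] := cmlbounded_iter_integral mb w0.
rewrite IHw//; apply/funext => x; rewrite !cintegral0E.
congr (_ +i* _); apply: ae_eq_oint.
- by under eq_fun do rewrite complex_ReM; apply: measurable_funB; exact: measurable_funM.
- by under eq_fun do rewrite complex_ReM; apply: measurable_funB; exact: measurable_funM.
- by apply: (aeS _ ab) => t ->.
- by under eq_fun do rewrite complex_ImM; apply: measurable_funD; exact: measurable_funM.
- by under eq_fun do rewrite complex_ImM; apply: measurable_funD; exact: measurable_funM.
- by apply: (aeS _ ab) => t ->.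
Qed.

Lemma eq_trivial_monodromy a b :
  (forall w, 0%N \notin w -> iter_integral a w = iter_integral b w) ->
  trivial_monodromy a -> trivial_monodromy b.
Proof.
move=> ab triv k; apply: val_inj.
transitivity (fund_sol a (k%:~R * (pi *+ 2))); last first.
  exact: (congr1 (fun g : fps_group (algA C) => sval g) (triv k)).
apply: fpsP => n; apply: (etrans (fund_sol_coefE b _ n)).
apply: (etrans _ (esym (fund_sol_coefE a _ n))).
rewrite [LHS]big_seq [RHS]big_seq; apply: eq_bigr => w.
by rewrite mem_compositions => /andP[w0 _]; rewrite ab.
Qed.

End Reduction.

Theorem theorem2p1 (R : realType) (a : nat -> R -> R[i]) (aX : in_X a) :
  determines_center a <-> trivial_monodromy a.
Proof.
have [aM [l l0 al]] := aX.
(* On the null set where some |a_i| exceeds l^i the coefficients are replaced by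
   0, which affects neither the solutions nor the iterated integrals. *)
pose A := [set x : R | forall i, (0 < i)%N -> Normc.normc (a i x) <= l ^+ i].
pose b i x := if (x \in A) && (0 < i)%N then a i x else 0.
have ab : {ae (@lebesgue_measure R), forall x, forall i, (0 < i)%N -> a i x = b i x}.
  have : {ae (@lebesgue_measure R), forall x, forall i, (0 < i)%N ->
      Normc.normc (a i x) <= l ^+ i}.
    apply/ae_foralln => -[|i]; first by apply: aeW.
    by have /ess_supP := al i.+1 isT; apply: aeS => x /=; rewrite lee_fin.
  by apply: aeS => x Ax i i0; rewrite /b i0 mem_set.
have mA : measurable A.
  rewrite (_ : A = \bigcap_(i in [set i | (0 < i)%N])
      [set x | Normc.normc (a i x) <= l ^+ i])//.
  apply: bigcap_measurable => [|i i0]; first by exists 1%N.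
  have [mr mi _] := aM i i0.
  rewrite (_ : [set x | _] = (fun x => complex.Re (a i x) ^+ 2 +
      complex.Im (a i x) ^+ 2) @^-1` `]-oo, (l ^+ i) ^+ 2]).
    rewrite -[X in measurable X]setTI; apply: measurable_funD => //;
      exact: measurable_funX.
  by apply/seteqP; split => x /=; rewrite in_itv/=; case: (a i x) => u v /=;
    rewrite -[X in Num.sqrt _ <= X]ger0_norm ?exprn_ge0 ?(ltW l0)//
      -sqrtr_sqr ler_sqrt// sqr_ge0.
(* Passing to [norm1] costs a factor 2, absorbed into (2 l)^i since i >= 1. *)
have bl i x : (0 < i)%N -> norm1 (b i x) <= (2 * l) ^+ i.
  move=> i0; rewrite /b i0 andbT; case: ifPn => [/set_mem Ax|_]; last first.
    by rewrite norm10 exprn_ge0// mulr_ge0// ltW.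
  rewrite (le_trans (norm1_le_normc _))// exprMn ler_pM ?Ax//.
    by case: (a i x) => ? ? /=; exact: sqrtr_ge0.
  by case: i i0 {Ax} => // i _; rewrite exprS ler_peMr// exprn_ege1// ler1n.
have mb i : (0 < i)%N -> cmlbounded (b i).
  move=> i0; have [mr mi _] := aM i i0.
  have bE x : b i x = if x \in A then a i x else 0 by rewrite /b i0 andbT.
  have m1 : measurable_fun [set: R] (\1_A : R -> R) by exact: measurable_indic.
  apply: cmlbounded_norm1; last by exists ((2 * l) ^+ i) => x; exact: bl.
    rewrite (_ : (fun x => _) = (fun x => complex.Re (a i x) * \1_A x)).
      exact: measurable_funM.
    by apply/funext => x; rewrite bE indicE; case: ifP; rewrite ?mulr1 ?mulr0.
  rewrite (_ : (fun x => _) = (fun x => complex.Im (a i x) * \1_A x)).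
    exact: measurable_funM.
  by apply/funext => x; rewrite bE indicE; case: ifP; rewrite ?mulr1 ?mulr0.
(* [A] is invariant under translation by 2 pi because it is defined by pointwise conditions on the
   periodic a_j; hence the truncation keeps periodicity. *)
have bT i : (0 < i)%N -> periodic (b i) (pi *+ 2).
  move=> i0 x; have aP j : (0 < j)%N -> a j (x + pi *+ 2) = a j x.
    by move=> j0; have [_ _ ->] := aM j j0.
  rewrite /b aP//; congr (if _ && _ then _ else _).
  by apply/idP/idP => /set_mem Ax; apply/mem_set => j j0; have := Ax j j0;
    rewrite aP.
have l20 : 0 < 2 * l by rewrite mulr_gt0.
have ba : {ae (@lebesgue_measure R), forall x, forall i, (0 < i)%N -> b i x = a i x}.
  by apply: aeS ab => x H i /H.
have ma i : (0 < i)%N -> measurable_fun [set: R] (fun x => complex.Re (a i x)) /\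
     measurable_fun [set: R] (fun x => complex.Im (a i x)).
  by move=> /aM [].
have II w : 0%N \notin w -> iter_integral a w = iter_integral b w.
  by move=> w0; exact: ae_eq_iter_integral.
have main := bounded_center_monodromy l20 mb bl bT.
split=> [[r r0 cen]|triv].
  apply: (@eq_trivial_monodromy _ b); first by move=> w /II.
  apply/main; exists r => // v sol; apply: cen; exact: ae_eq_is_solution sol.
have [r r0 cen] : determines_center b.
  by apply/main; exact: eq_trivial_monodromy triv.
by exists r => // v sol; apply: cen; exact: ae_eq_is_solution sol.
Qed.
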